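(* There exist a closed target manifold $(N,g_N)$ and a solution $(u(t),g(t))$, $t\in[0,\infty)$, of Teichmüller harmonic map flow from $T^2$ into $(N,g_N)$ for which the metric component stays in a compact subset of Teichmüller space but for which the limit as $t\to\infty$ is not unique. In particular, there are sequences of times $t_i,\tilde t_i\to\infty$ so that $(u(t_i),g(t_i))$ and $(u(\tilde t_i),g(\tilde t_i))$ converge (without having to pull back by diffeomorphisms) to limits which parametrise different minimal surfaces in $(N,g_N)$.
   Context: Let $T^2=\mathbb{R}^2/\mathbb{Z}^2$ and let $\mathcal{M}_0$ be the space of smooth flat unit-area metrics on $T^2$. Teichmüller space is the quotient of $\mathcal{M}_0$ by pull-back by diffeomorphisms homotopic to the identity. It can be identified with $\mathcal{M}^*=\{g_{a,b}:(a,b)\in\mathbb{H}\}$, where $\mathbb{H}$ is the upper half plane and $g_{a,b}=T_{a,b}^*g_E$ with $g_E$ Euclidean and $T_{a,b}$ linear, $(1,0)\mapsto\frac1{\sqrt b}(1,0)$, $(0,1)\mapsto\frac1{\sqrt b}(a,b)$. Teichmüller harmonic map flow from $T^2$: fix a parameter $\eta>0$. For a map $u\colon T^2\to N$ and $g\in\mathcal{M}_0$ the Dirichlet energy is $E(u,g)=\frac12\int_{T^2}|du|_g^2\,dv_g$. The flow is its gradient flow $$\frac{\partial u}{\partial t}=\tau_g(u),\qquad \frac{\partial g}{\partial t}=\frac{\eta^2}{4}\mathrm{Re}\big(P_g(\Phi(u,g))\big),$$ where $\tau_g(u)=\mathrm{tr}_g\nabla du$ is the tension field, $\Phi(u,g)$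 is the Hopf differential, i.e. $\Phi(u,g)=(|u_x|^2-|u_y|^2-2i\langle u_x,u_y\rangle)\,dz^2$ in local isothermal coordinates $z=x+iy$ of $(T^2,g)$, and $P_g$ is the $L^2(T^2,g)$-orthogonal projection from quadratic differentials onto the space of holomorphic quadratic differentials on $(T^2,g)$. Target manifolds are smooth closed Riemannian manifolds. Convergence is smooth convergence; the limits $(u_\infty,g_\infty)$, $(\tilde u_\infty,\tilde g_\infty)$ parametrise different minimal surfaces if $u_\infty,\tilde u_\infty$ are minimal immersions with different images in $N$. *)

(* Defs.v *)
From HB Require Import structures.
From mathcomp Require Import all_boot all_order all_algebra complex.
From mathcomp Require Import all_classical all_reals all_analysis.
Set Implicit Arguments.
Unset Strict Implicit.
Unset Printing Implicit Defensive.
Import Order.TTheory GRing.Theory Num.Theory numFieldNormedType.Exports.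
Local Open Scope classical_set_scope.
Local Open Scope ring_scope.

(* Throughout, vectors are row vectors.  Accordingly the matrix dmx f x of the
   differential of f has the partial derivatives of f as its ROWS, a bilinear
   form A acts by (X, Y) |-> X *m A *m Y^T, and the pull-back of A by f is
   J *m A *m J^T with J := dmx f x. *)

(** * Smoothness *)

Section Smoothness.
Context {R : realType}.

Fixpoint iter_derive {V W : normedModType R} (vs : seq V) (f : V -> W) :
    V -> W :=
  if vs is v :: vs' then 'D_v (iter_derive vs' f) else f.

(* On finite-dimensional V, which is the only case used, this is C^oo on the
   open set O. *)
Definition smooth_open {V W : normedModType R} (O : set V) (f : V -> W) : Prop :=
  forall (vs : seq V) (x : V), O x ->
    {for x, continuous (iter_derive vs f)} /\
    (forall v, derivable (iter_derive vs f) x v).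

(* Smoothness on an arbitrary set A (e.g. one with boundary): local
   extendability to a smooth function on an open set. *)
Definition smooth_on {V W : normedModType R} (A : set V) (f : V -> W) : Prop :=
  forall x, A x -> exists (O : set V) (F : V -> W),
    [/\ open O, O x, smooth_open O F & forall y, O y -> A y -> f y = F y].

Definition partial {m : nat} {W : normedModType R} (i : 'I_m)
    (f : 'rV[R]_m -> W) : 'rV[R]_m -> W :=
  'D_(delta_mx 0 i) f.

Definition dmx {m n : nat} (f : 'rV[R]_m -> 'rV[R]_n) (x : 'rV[R]_m) :
    'M[R]_(m, n) :=
  \matrix_(i, j) partial i f x 0 j.

Definition pullback {m n : nat} (f : 'rV[R]_m -> 'rV[R]_n)
    (A : 'rV[R]_n -> 'M[R]_n) (x : 'rV[R]_m) : 'M[R]_m :=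
  dmx f x *m A (f x) *m (dmx f x)^T.

Definition posdef {n : nat} (A : 'M[R]_n) : Prop :=
  A^T = A /\ forall v : 'rV[R]_n, v != 0 -> 0 < (v *m A *m v^T) 0 0.

End Smoothness.

(** * Riemannian geometry in coordinates *)

Section Coordinates.
Context {R : realType}.

(* Gamma^k_{ij} *)
Definition christoffel {m : nat} (g : 'rV[R]_m -> 'M[R]_m) (k i j : 'I_m)
    (x : 'rV[R]_m) : R :=
  2^-1 * \sum_l invmx (g x) k l *
    (partial i (fun y => g y j l) x + partial j (fun y => g y i l) x
     - partial l (fun y => g y i j) x).

(* R^l_{ijk}, with R(d_i, d_j) d_k = \sum_l R^l_{ijk} d_l *)
Definition curvature {m : nat} (g : 'rV[R]_m -> 'M[R]_m) (l i j k : 'I_m)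
    (x : 'rV[R]_m) : R :=
  partial i (christoffel g l j k) x - partial j (christoffel g l i k) x
  + \sum_p (christoffel g l i p x * christoffel g p j k x
            - christoffel g l j p x * christoffel g p i k x).

(* tr_g (nabla dU) for U from a domain with metric g to a target with
   metric G, both given in coordinates. *)
Definition tension {m n : nat} (g : 'rV[R]_m -> 'M[R]_m)
    (G : 'rV[R]_n -> 'M[R]_n) (U : 'rV[R]_m -> 'rV[R]_n) (x : 'rV[R]_m) :
    'rV[R]_n :=
  \row_k \sum_i \sum_j invmx (g x) i j *
    (partial i (partial j U) x 0 k
     - \sum_l christoffel g l i j x * partial l U x 0 k
     + \sum_a \sum_b christoffel G k a b (U x)
                     * partial i U x 0 a * partial j U x 0 b).

End Coordinates.

(** * Closed Riemannian manifolds *)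

(* The metric is given by its coordinate matrices cmetric i, as functions of
   the coordinates of the i-th chart. *)
Record closedRiemannian (R : realType) (n : nat) := ClosedRiemannian {
  carrier :> topologicalType ;
  chart_index : Type ;
  dom : chart_index -> set carrier ;
  chart : chart_index -> carrier -> 'rV[R]_n ;
  param : chart_index -> 'rV[R]_n -> carrier ;
  cmetric : chart_index -> 'rV[R]_n -> 'M[R]_n ;
  carrier_compact : compact [set: carrier] ;
  carrier_hausdorff : hausdorff_space carrier ;
  dom_cover : forall y : carrier, exists i, dom i y ;
  dom_open : forall i, open (dom i) ;
  codom_open : forall i, open (chart i @` dom i) ;
  chartK : forall i y, dom i y -> param i (chart i y) = y ;
  chart_cont : forall i y, dom i y -> {for y, continuous (chart i)} ;
  param_cont : forall i p, (chart i @` dom i) p ->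
    {for p, continuous (param i)} ;
  transition_smooth : forall i j,
    smooth_open (chart i @` (dom i `&` dom j)) (chart j \o param i) ;
  cmetric_smooth : forall i, smooth_open (chart i @` dom i) (cmetric i) ;
  cmetric_posdef : forall i y, dom i y -> posdef (cmetric i (chart i y)) ;
  cmetric_transition : forall i j y, dom i y -> dom j y ->
    cmetric i (chart i y) =
    pullback (chart j \o param i) (cmetric j) (chart i y)
}.
Arguments dom {R n c} _ _.
Arguments chart {R n c} _ _.
Arguments param {R n c} _ _.
Arguments cmetric {R n c} _ _.

Section MapsIntoManifold.
Context {R : realType} {n : nat} {N : closedRiemannian R n}.

Definition smooth_into {V : normedModType R} (A : set V) (f : V -> N) : Prop :=
  forall x (c : chart_index N), A x -> dom c (f x) ->
    exists (O : set V) (F : V -> 'rV[R]_n),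
      [/\ open O, O x, smooth_open O F
        & forall y, O y -> A y -> dom c (f y) /\ chart c (f y) = F y].

(* f^* g_N, computed in the chart c; meaningful where f takes values in dom c *)
Definition pullback_metric {m : nat} (c : chart_index N) (f : 'rV[R]_m -> N) :
    'rV[R]_m -> 'M[R]_m :=
  pullback (chart c \o f) (cmetric c).

End MapsIntoManifold.

(** * The torus R^2 / Z^2 *)

(* Functions and tensor fields on the torus are Z^2-periodic functions on R^2;
   continuous maps from the torus to itself are given by lifts to R^2. *)

Section Torus.
Context {R : realType}.

Definition vec2 (x y : R) : 'rV[R]_2 := \row_(j < 2) [:: x; y]`_j.

Definition lattice : set 'rV[R]_2 := [set v | forall j, v 0 j \is a Num.int].

Definition periodic {T : Type} (f : 'rV[R]_2 -> T) : Prop :=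
  forall x v, lattice v -> f (x + v) = f x.

Definition torus_integral (f : 'rV[R]_2 -> R) : R :=
  Rintegral (lebesgue_measure \x lebesgue_measure)%E
    (`[0, 1] `*` `[0, 1]) (fun z : R * R => f (vec2 z.1 z.2)).

(* The space M_0 of smooth flat unit-area metrics. *)
Definition flat_unit_metric (g : 'rV[R]_2 -> 'M[R]_2) : Prop :=
  [/\ periodic g, smooth_open setT g, forall x, posdef (g x),
      forall l i j k x, curvature g l i j k x = 0
    & torus_integral (fun x => Num.sqrt (\det (g x))) = 1].

Definition torus_map (f : 'rV[R]_2 -> 'rV[R]_2) : Prop :=
  forall x v, lattice v -> lattice (f (x + v) - f x).

Definition torus_diffeo (f : 'rV[R]_2 -> 'rV[R]_2) : Prop :=
  [/\ torus_map f, smooth_open setT f &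
    exists h, [/\ torus_map h, smooth_open setT h,
      forall x, lattice (h (f x) - x) & forall x, lattice (f (h x) - x)]].

Definition homotopic_to_id (f : 'rV[R]_2 -> 'rV[R]_2) : Prop :=
  exists H : R * 'rV[R]_2 -> 'rV[R]_2,
    [/\ {within `[0, 1] `*` setT, continuous H},
        forall s, s \in `[0, 1] -> torus_map (fun x => H (s, x)),
        forall x, lattice (H (0, x) - x)
      & forall x, lattice (H (1, x) - f x)].

Definition teich_equiv (g h : 'rV[R]_2 -> 'M[R]_2) : Prop :=
  exists f, [/\ torus_diffeo f, homotopic_to_id f & g = pullback f h].

(* g_{a,b} = T_{a,b}^* g_E *)
Definition teich_rep (ab : R * R) : 'rV[R]_2 -> 'M[R]_2 :=
  let T := (Num.sqrt ab.2)^-1 *: col_mx (vec2 1 0) (vec2 ab.1 ab.2) in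
  pullback (mulmx^~ T) (fun _ => 1%:M).

(* Teichmueller space carries the topology of the upper half plane, under its
   identification with the set of the metrics g_{a,b}. *)
Definition in_teich_compact (P : set ('rV[R]_2 -> 'M[R]_2)) : Prop :=
  exists K : set (R * R),
    [/\ compact K, K `<=` [set ab | 0 < ab.2]
      & forall g, P g -> exists2 ab, K ab & teich_equiv g (teich_rep ab)].

End Torus.

(** * Quadratic differentials *)

(* A quadratic differential is given by its complex-valued symmetric bilinear
   form phi (dx + i dy) (x) (dx + i dy), in the coordinates of the torus. *)

Section QuadraticDifferentials.
Context {R : realType}.

(* xi is the inverse of an (oriented) local isothermal coordinate of the torus
   with metric g: it sends x + iy in O to the point with coordinate x + iy. *)
Definition isothermal (g : 'rV[R]_2 -> 'M[R]_2) (O : set 'rV[R]_2)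
    (xi : 'rV[R]_2 -> 'rV[R]_2) : Prop :=
  [/\ open O, smooth_open O xi,
      forall z w, O z -> O w -> lattice (xi z - xi w) -> z = w,
      forall z, O z -> 0 < \det (dmx xi z)
    & forall z, O z -> exists2 lambda, 0 < lambda &
        pullback xi g z = lambda%:M].

Definition dz : 'rV[R[i]]_2 := \row_(j < 2) [:: 1; 'i%C]`_j.

Definition dz2 : 'M[R[i]]_2 := dz^T *m dz.

Definition cpullback (xi : 'rV[R]_2 -> 'rV[R]_2) (q : 'rV[R]_2 -> 'M[R[i]]_2)
    (z : 'rV[R]_2) : 'M[R[i]]_2 :=
  let J := map_mx (real_complex R) (dmx xi z) in J *m q (xi z) *m J^T.

Definition hopf_differential {n : nat} {N : closedRiemannian R n}
    (u : 'rV[R]_2 -> N) (g : 'rV[R]_2 -> 'M[R]_2)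
    (Phi : 'rV[R]_2 -> 'M[R[i]]_2) : Prop :=
  periodic Phi /\
  forall O xi z (c : chart_index N),
    isothermal g O xi -> O z -> dom c (u (xi z)) ->
    let h := pullback_metric c (u \o xi) z in
    cpullback xi Phi z =
      Complex (h 0 0 - h 1 1) (- (2 * h 0 1)) *: dz2.

(* Complex differentiability is derivability over the field R[i]. *)
Definition holomorphic_differential (g : 'rV[R]_2 -> 'M[R]_2)
    (q : 'rV[R]_2 -> 'M[R[i]]_2) : Prop :=
  periodic q /\
  forall O xi, isothermal g O xi -> exists phi : (R[i])^o -> (R[i])^o,
    forall z : (R[i])^o, O (vec2 (complex.Re z) (complex.Im z)) ->
      cpullback xi q (vec2 (complex.Re z) (complex.Im z)) = phi z *: dz2 /\
      derivable phi z 1.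

(* \int g^{ik} g^{jl} q_{ij} (r_{kl})^* dv_g *)
Definition L2_inner (g : 'rV[R]_2 -> 'M[R]_2) (q r : 'rV[R]_2 -> 'M[R[i]]_2) :
    R[i] :=
  let ginv x := map_mx (real_complex R) (invmx (g x)) in
  let rbar x := map_mx (fun z : R[i] => z^*) (r x) in
  let p x := \tr (ginv x *m q x *m ginv x *m (rbar x)^T) in
  let dv x := Num.sqrt (\det (g x)) in
  Complex (torus_integral (fun x => complex.Re (p x) * dv x))
          (torus_integral (fun x => complex.Im (p x) * dv x)).

(* h = P_g (q) *)
Definition holomorphic_projection (g : 'rV[R]_2 -> 'M[R]_2)
    (q h : 'rV[R]_2 -> 'M[R[i]]_2) : Prop :=
  holomorphic_differential g h /\
  forall k, holomorphic_differential g k -> L2_inner g (fun x => q x - h x) k = 0.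

End QuadraticDifferentials.

(** * Teichmueller harmonic map flow *)

Section Flow.
Context {R : realType} {n : nat} {N : closedRiemannian R n}.

(* A solution on [0, oo), smooth up to time 0; by continuity it is enough to
   impose the equations for positive times.  The values of u and g at negative
   times are irrelevant. *)
Definition teichmuller_flow (eta : R) (u : R -> 'rV[R]_2 -> N)
    (g : R -> 'rV[R]_2 -> 'M[R]_2) : Prop :=
  [/\ forall t, 0 <= t -> periodic (u t) /\ flat_unit_metric (g t),
      smooth_into ([set t : R | 0 <= t] `*` [set: 'rV[R]_2])
        (fun p => u p.1 p.2),
      smooth_on ([set t : R | 0 <= t] `*` [set: 'rV[R]_2])
        (fun p => g p.1 p.2),
      forall t x (c : chart_index N), 0 < t -> dom c (u t x) ->
        'D_1 (fun s => chart c (u s x)) t =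
        tension (g t) (cmetric c) (chart c \o u t) x
    & forall t, 0 < t -> exists Phi h : 'rV[R]_2 -> 'M[R[i]]_2,
        [/\ hopf_differential (u t) (g t) Phi,
            holomorphic_projection (g t) Phi h
          & forall x, 'D_1 (fun s => g s x) t =
              (eta ^+ 2 / 4) *: map_mx (@complex.Re R) (h x)]].

(* Smooth convergence of maps from the torus, along a filter F on the index. *)
Definition smooth_cvg_map {I : Type} (F : set_system I)
    (u : I -> 'rV[R]_2 -> N) (u_oo : 'rV[R]_2 -> N) : Prop :=
  forall x (c : chart_index N), dom c (u_oo x) ->
    exists V : set 'rV[R]_2,
      [/\ nbhs x V,
          forall y, V y -> dom c (u_oo y),
          \forall i \near F, forall y, V y -> dom c (u i y)
        & forall vs (e : R), 0 < e -> \forall i \near F, forall y, V y ->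
            `|iter_derive vs (chart c \o u i) y
              - iter_derive vs (chart c \o u_oo) y| < e].

Definition smooth_cvg_metric {I : Type} (F : set_system I)
    (g : I -> 'rV[R]_2 -> 'M[R]_2) (g_oo : 'rV[R]_2 -> 'M[R]_2) : Prop :=
  forall vs (e : R), 0 < e -> \forall i \near F, forall x,
    `|iter_derive vs (g i) x - iter_derive vs g_oo x| < e.

Definition smooth_cvg {I : Type} (F : set_system I)
    (u : I -> 'rV[R]_2 -> N) (g : I -> 'rV[R]_2 -> 'M[R]_2)
    (u_oo : 'rV[R]_2 -> N) (g_oo : 'rV[R]_2 -> 'M[R]_2) : Prop :=
  [/\ periodic u_oo, smooth_into setT u_oo, flat_unit_metric g_oo,
      smooth_cvg_map F u u_oo & smooth_cvg_metric F g g_oo].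

(* The mean curvature of an immersion u is, up to normalisation, the trace
   with respect to u^* g_N of its second fundamental form, i.e. of nabla du
   where the domain carries the metric u^* g_N. *)
Definition minimal_immersion (u : 'rV[R]_2 -> N) : Prop :=
  [/\ periodic u, smooth_into setT u
    & forall x (c : chart_index N), dom c (u x) ->
        row_free (dmx (chart c \o u) x) /\
        tension (pullback_metric c u) (cmetric c) (chart c \o u) x = 0].

Definition different_minimal_surfaces (u v : 'rV[R]_2 -> N) : Prop :=
  [/\ minimal_immersion u, minimal_immersion v & range u <> range v].

End Flow.

(* Main.v *)
Require Import Defs.
From mathcomp Require Import all_boot all_order all_algebra complex.
From mathcomp Require Import all_classical all_reals all_analysis.
From mathcomp Require Import zify ring lra.
Set Implicit Arguments.
Unset Strict Implicit.
Unset Printing Implicit Defensive.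
Import Order.TTheory GRing.Theory Num.Theory numFieldNormedType.Exports.
Local Open Scope classical_set_scope.
Local Open Scope ring_scope.

(** The example is a gradient flow in disguise.  The target is a 4-dimensional
torus with coordinates (p1, p2, x, th) and metric
w (dp1^2 + dp2^2) + dx^2 + b dth^2, where w and b depend on (x, th) only.  The
horizontal torus over a point (x, th), parametrised by the square torus in the
coordinates p1, p2, is homothetic to it.  Hence its Hopf differential vanishes,
so that the square metric of the domain never moves ([hopf_slice]), and its
tension is vertical, equal to minus the gradient of w in the (x, th)-torus
([tension_slice], [tension_target]).  So every gradient line of w is a solution
of the flow with constant domain metric, and horizontal tori over critical
points are minimal.

It remains to choose w such that a gradient line does not converge.  Take the
Mexican-hat function w = 1 + e^(-1/r) (1 - c sin (th - 1/r)) for r = tan x > 0,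
extended by 1 to x <= 0: it is flat to infinite order along the circle x = 0,
which consists of critical points.  The spiral th = 1/r is where the sine
vanishes, and there dw = e^(-th) ((1 - c) / sin^2 x dx - c dth).  With
c = 1 - sin^4 x and b = c, minus the gradient is e^(-th) (- sin^2 x, 1), which
is tangent to the spiral; the gradient line is th = ln (t + K),
x = atan (1 / th) ([force_spiral], [is_derive_spiral]).  It accumulates on the
whole circle x = 0, and along times with th = 0, resp. pi, modulo 2 pi the maps
converge smoothly to the minimal tori over (0, 0), resp. (0, pi), which are
disjoint.

To define these functions on the whole torus, w and b are modified by cut-offs
where sin^2 x > 1/2, a region the spiral never enters.  Smoothness, i.e. the
existence and continuity of all iterated directional derivatives, is proved by
exhibiting classes of functions stable under one differentiation
([smooth_open_class]); for the flat functions e^(-1/r) cos (1/r + a) the class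
is their span after multiplication by powers of 1/r ([smooth_flat]).  The closed
manifold is the quotient of R^4 by a lattice, with the local inverses of the
projection as charts ([riemannian_torus]). *)

(** * Iterated directional derivatives *)

Section SmoothCalculus.
Context {R : realType} {V : normedModType R}.

Lemma near_eq_iter_derive {W : normedModType R} (vs : seq V) (f g : V -> W)
    (x : V) :
  (\near x, f x = g x) ->
  \near x, iter_derive vs f x = iter_derive vs g x.
Proof.
move=> fg; elim: vs => [|v vs IH] //=.
by apply: filterS (nbhs_interior IH) => y fgy; exact: near_eq_derive fgy.
Qed.

Lemma near_eq_continuous {W : topologicalType} (f g : V -> W) (x : V) :
  (\near x, f x = g x) -> {for x, continuous f} -> {for x, continuous g}.
Proof.
move=> fg cf; have cfx : f @ x --> f x := cf.
suff : g @ x --> g x by [].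
rewrite -(nbhs_singleton fg); apply: cvg_trans cfx; apply: near_eq_cvg.
by apply: filterS fg => y ->.
Qed.

Lemma smooth_open_local {W : normedModType R} (O : set V) (f : V -> W) :
  (forall x, O x -> exists (P : set V) (g : V -> W),
     [/\ nbhs x P, smooth_open P g & forall y, P y -> f y = g y]) ->
  smooth_open O f.
Proof.
move=> loc vs x Ox; have [P [g [Px sg fg]]] := loc x Ox.
have gf : \near x, iter_derive vs g x = iter_derive vs f x.
  by apply: near_eq_iter_derive; apply: filterS Px => y /fg ->.
have [cg dg] := sg vs x (nbhs_singleton Px); split.
  exact: near_eq_continuous gf cg.
by move=> v; apply: near_eq_derivable (dg v).
Qed.

Lemma smooth_openS {W : normedModType R} (O P : set V) (f : V -> W) :
  O `<=` P -> smooth_open P f -> smooth_open O f.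
Proof. by move=> OP sf vs x /OP; apply: sf. Qed.

(** If one differentiation maps a class of functions into itself, then it can
be iterated.  With a suitable class, this proves smoothness without a formula
for any higher derivative. *)
Lemma smooth_open_class {W : normedModType R} (O : set V)
    (C : set (V -> W)) :
  open O ->
  (forall f, C f -> forall x, O x -> {for x, continuous f}) ->
  (forall f, C f -> forall v, exists2 g, C g &
     forall x, O x -> is_derive x v f (g x)) ->
  forall f, C f -> smooth_open O f.
Proof.
move=> oO Ccont Cder f Cf vs.
have [g Cg fg] : exists2 g, C g & forall x, O x -> iter_derive vs f x = g x.
  elim: vs => [|v vs [g Cg fg]] /=; first by exists f.
  have [h Ch gh] := Cder g Cg v; exists h => // x Ox.
  have [_ <-] := gh x Ox; apply: near_eq_derive.
  by apply: filterS (open_nbhs_nbhs (conj oO Ox)) => y /fg.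
move=> x Ox.
have gf : \near x, g x = iter_derive vs f x.
  by apply: filterS (open_nbhs_nbhs (conj oO Ox)) => y /fg.
split; first exact: near_eq_continuous gf (Ccont g Cg x Ox).
move=> v; apply: near_eq_derivable gf _.
by have [h _ gh] := Cder g Cg v; have [] := gh x Ox.
Qed.

Lemma smooth_open_continuous {W : normedModType R} (O : set V) (f : V -> W) x :
  smooth_open O f -> O x -> {for x, continuous f}.
Proof. by move=> sf Ox; have [] := sf [::] x Ox. Qed.

Lemma smooth_open_derivable {W : normedModType R} (O : set V) (f : V -> W)
    x v :
  smooth_open O f -> O x -> derivable f x v.
Proof. by move=> sf Ox; have [_] := sf [::] x Ox. Qed.

Lemma iter_derive_cat {W : normedModType R} (vs ws : seq V) (f : V -> W) :
  iter_derive (vs ++ ws) f = iter_derive vs (iter_derive ws f).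
Proof. by elim: vs => //= v vs ->. Qed.

Lemma smooth_open_derive {W : normedModType R} (O : set V) (f : V -> W) v :
  smooth_open O f -> smooth_open O ('D_v f).
Proof.
move=> sf vs x Ox.
by have := sf (vs ++ [:: v]) x Ox; rewrite iter_derive_cat.
Qed.

Lemma smooth_open_primitive {W : normedModType R} (O : set V) (f : V -> W) :
  open O -> (forall x, O x -> {for x, continuous f}) ->
  (forall v, exists2 g, smooth_open O g &
     forall x, O x -> is_derive x v f (g x)) ->
  smooth_open O f.
Proof.
move=> oO cf df.
apply: (@smooth_open_class _ O [set h | h = f \/ smooth_open O h]) => //.
- move=> h [->|sh x Ox]; first exact: cf.
  exact: smooth_open_continuous sh Ox.
- move=> h [->|sh] v.
    by have [g sg fg] := df v; exists g => //; right.
  exists ('D_v h); first by right; exact: smooth_open_derive.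
  by move=> x Ox; apply: derivableP; exact: smooth_open_derivable sh Ox.
- by left.
Qed.

Lemma smooth_open_cst {W : normedModType R} (O : set V) (k : W) :
  open O -> smooth_open O (cst k : V -> W).
Proof.
move=> oO; apply: (@smooth_open_class _ O [set h | exists c, h = cst c]) => //.
- by move=> _ [c ->] x _; exact: cvg_cst.
- move=> _ [c ->] v; exists (cst 0); first by exists 0.
  by move=> x _; exact: is_derive_cst.
- by exists k.
Qed.

Lemma is_derive_affine {W : normedModType R} (f : {linear V -> W}) (k : W)
  (x v : V) :
  is_derive x v (fun y => f y + k) (f v).
Proof.
have quot : forall h : R, h != 0 ->
    h^-1 *: (((fun y => f y + k) \o shift x) (h *: v) - (f x + k)) = f v.
  move=> h h0 /=; rewrite linearP opprD addrACA subrr addr0 addrK.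
  by rewrite scalerA mulVf// scale1r.
have cvgl : h^-1 *: (((fun y => f y + k) \o shift x) (h *: v) - (f x + k))
    @[h --> 0^'] --> f v.
  apply: cvg_near_cst; near=> h; apply: quot.
  by near: h; exact: nbhs_dnbhs_neq.
by apply: DeriveDef; [apply/cvg_ex; exists (f v)|exact: cvg_lim].
Unshelve. all: by end_near. Qed.

Lemma smooth_open_linear {W : normedModType R} (O : set V)
    (f : {linear V -> W}) :
  open O -> continuous f -> smooth_open O f.
Proof.
move=> oO cf; apply: smooth_open_primitive => // [x _|v]; first exact: cf.
exists (cst (f v)); first exact: smooth_open_cst.
move=> x _; have := is_derive_affine f 0 x v.
by congr is_derive; apply/funext => y; rewrite addr0.
Qed.

Lemma smooth_open_id (O : set V) : open O -> smooth_open O (@id V).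
Proof.
by move=> oO; apply: (smooth_open_linear (f := idfun)) => // x; exact: cvg_id.
Qed.

(** A directional derivative only sees the restriction to a line, which reduces
the chain rule with an outer function of one variable to calculus on [R]. *)
Lemma is_derive_line {W : normedModType R} (f : V -> W) x v d :
  is_derive x v f d <-> is_derive (0 : R) 1 (fun h => f (h *: v + x)) d.
Proof.
have quot : (fun h : R => h^-1 *: ((f \o shift x) (h *: v) - f x)) =
   (fun h => h^-1 *: (((fun h => f (h *: v + x)) \o shift 0) (h *: (1 : R))
      - f (0 *: v + x))).
  apply/funext => h /=; congr (_ *: (f (_ *: _ + _) - f _)).
  - by rewrite addr0 [h *: 1]mulr1.
  - by rewrite scale0r add0r.
by split=> -[df <-]; apply: DeriveDef; move: df;
  rewrite /derivable /derive quot.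
Qed.

Lemma is_derive_comp1 (phi : R -> R) (f : V -> R) x v a b :
  is_derive (f x) 1 phi a -> is_derive x v f b ->
  is_derive x v (phi \o f) (a * b).
Proof.
move=> dphi /is_derive_line df; apply/is_derive_line.
apply: (@is_derive1_comp _ phi (fun h => f (h *: v + x)) 0 a b) => //.
by rewrite scale0r add0r.
Qed.

End SmoothCalculus.

Section SmoothAlgebra.
Context {R : realType} {V : normedModType R}.

(** Closed under differentiation by the product and chain rules: the
derivative of [phi \o f] is a product of a composition and a smooth function. *)
Inductive smooth_alg (O : set V) : (V -> R) -> Prop :=
| SmoothBase f : smooth_open O f -> smooth_alg O f
| SmoothComp (U : set R) phi f : smooth_open U phi -> smooth_open O f ->
    (forall x, O x -> U (f x)) -> smooth_alg O (phi \o f)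
| SmoothAdd f g : smooth_alg O f -> smooth_alg O g -> smooth_alg O (f + g)
| SmoothMul f g : smooth_alg O f -> smooth_alg O g -> smooth_alg O (f * g).

Lemma smooth_alg_open (O : set V) f :
  open O -> smooth_alg O f -> smooth_open O f.
Proof.
move=> oO; apply: smooth_open_class => // {f}.
- move=> f.
  elim=> {f} [f sf|U phi f sphi sf Uf|f g _ cf _ cg|f g _ cf _ cg] x Ox.
  + exact: smooth_open_continuous sf Ox.
  + apply: continuous_comp; first exact: smooth_open_continuous sf Ox.
    exact: smooth_open_continuous sphi (Uf x Ox).
  + by apply: continuousD; [exact: cf|exact: cg].
  + by apply: continuousM; [exact: cf|exact: cg].
- move=> f Af v; elim: Af => {f} [f sf|U phi f sphi sf Uf
    |f g _ [f' Af ff'] _ [g' Ag gg']|f g Af0 [f' Af ff'] Ag0 [g' Ag gg']].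
  + exists ('D_v f); first by apply: SmoothBase; exact: smooth_open_derive.
    by move=> x Ox; apply: derivableP; exact: smooth_open_derivable sf Ox.
  + exists (('D_1 phi \o f) * 'D_v f).
      apply: SmoothMul; last by apply: SmoothBase; exact: smooth_open_derive.
      exact: (SmoothComp (smooth_open_derive _ sphi) sf Uf).
    move=> x Ox; apply: is_derive_comp1.
      by apply: derivableP; exact: smooth_open_derivable sphi (Uf x Ox).
    by apply: derivableP; exact: smooth_open_derivable sf Ox.
  + exists (f' + g'); first exact: SmoothAdd.
    move=> x Ox; have dg := gg' x Ox; have df := ff' x Ox.
    exact: is_deriveD.
  + exists (f * g' + g * f').
      by apply: SmoothAdd; apply: SmoothMul.
    move=> x Ox; have dg := gg' x Ox; have df := ff' x Ox.
    exact: is_deriveM.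
Qed.

Lemma smooth_open_comp (O : set V) (U : set R) (phi : R -> R) (f : V -> R) :
  open O ->
  smooth_open U phi -> smooth_open O f -> (forall x, O x -> U (f x)) ->
  smooth_open O (fun x => phi (f x)).
Proof.
move=> oO sphi sf Uf; apply: smooth_alg_open => //.
exact: (SmoothComp sphi sf).
Qed.

Lemma smooth_openD {W : normedModType R} (O : set V) (f g : V -> W) :
  open O -> smooth_open O f -> smooth_open O g ->
  smooth_open O (fun x => f x + g x).
Proof.
move=> oO sf sg.
pose C : set (V -> W) := [set h | exists f' g',
  [/\ smooth_open O f', smooth_open O g' & h = f' + g']].
apply: (@smooth_open_class _ _ _ O C) => //; last by exists f, g.
- move=> _ [f' [g' [sf' sg' ->]]] x Ox; apply: continuousD.
    exact: smooth_open_continuous sf' Ox.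
  exact: smooth_open_continuous sg' Ox.
- move=> _ [f' [g' [sf' sg' ->]]] v; exists ('D_v f' + 'D_v g').
    exists ('D_v f'), ('D_v g'); split => //; exact: smooth_open_derive.
  move=> x Ox.
  have df : is_derive x v f' ('D_v f' x).
    by apply: derivableP; exact: smooth_open_derivable sf' Ox.
  have dg : is_derive x v g' ('D_v g' x).
    by apply: derivableP; exact: smooth_open_derivable sg' Ox.
  exact: is_deriveD.
Qed.

Lemma smooth_openM (O : set V) (f g : V -> R) : open O ->
  smooth_open O f -> smooth_open O g -> smooth_open O (fun x => f x * g x).
Proof.
move=> oO sf sg; apply: smooth_alg_open => //.
by apply: (@SmoothMul _ f g); apply: SmoothBase.
Qed.

Lemma smooth_openN (O : set V) (f : V -> R) : open O ->
  smooth_open O f -> smooth_open O (fun x => - f x).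
Proof.
move=> oO sf; have := smooth_openM oO (smooth_open_cst (-1 : R) oO) sf.
by congr smooth_open; apply/funext => x; rewrite mulN1r.
Qed.

Lemma smooth_openB (O : set V) (f g : V -> R) : open O ->
  smooth_open O f -> smooth_open O g -> smooth_open O (fun x => f x - g x).
Proof.
by move=> oO sf sg; exact: (smooth_openD oO sf (smooth_openN oO sg)).
Qed.

Lemma smooth_openX (O : set V) (f : V -> R) n : open O ->
  smooth_open O f -> smooth_open O (fun x => f x ^+ n).
Proof.
move=> oO sf; elim: n => [|n IH].
  exact: (smooth_open_cst (1 : R) oO).
have := smooth_openM oO sf IH.
by congr smooth_open; apply/funext => x; rewrite exprS.
Qed.

Lemma smooth_open_mx (O : set V) m n (f : V -> 'M[R]_(m, n)) : open O ->
  (forall i j, smooth_open O (fun x => f x i j)) -> smooth_open O f.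
Proof.
move=> oO sf.
pose C : set (V -> 'M[R]_(m, n)) :=
  [set h | forall i j, smooth_open O (fun x => h x i j)].
apply: (@smooth_open_class _ _ _ O C) => // {f sf}.
- move=> f sf x Ox; apply/cvgrPdist_lt => e e0; near=> y.
  rewrite [ltLHS]/Num.Def.normr/= mx_normrE.
  apply: bigmax_lt => // -[i j] _ /=; rewrite !mxE.
  move: i j; near: y; apply: filter_forall => i; apply: filter_forall => j.
  have /cvgrPdist_lt := smooth_open_continuous (sf i j) Ox; exact.
- move=> f sf v; exists (fun x => \matrix_(i, j) 'D_v (fun y => f y i j) x).
    move=> i j; have := smooth_open_derive v (sf i j).
    by congr smooth_open; apply/funext => x; rewrite mxE.
  move=> x Ox; have df : derivable f x v.
    by apply/derivable_mxP => i j; exact: smooth_open_derivable (sf i j) Ox.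
  by apply: DeriveDef => //; exact: derive_mx.
Unshelve. all: by end_near. Qed.

End SmoothAlgebra.

Section Translations.
Context {R : realType}.

Lemma derive_addcst {V W : normedModType R} (f : V -> W) (k : W) (v : V) :
  'D_v (fun x => f x + k) = 'D_v f.
Proof.
apply/funext => x; rewrite /derive.
rewrite (_ : (fun h : R => _) =
  fun h => h^-1 *: ((f \o shift x) (h *: v) - f x))//.
by apply/funext => h /=; rewrite opprD addrACA subrr addr0.
Qed.

Lemma iter_derive_addcst {V W : normedModType R} (vs : seq V) (f : V -> W)
    (k : W) x :
  iter_derive vs (fun x => f x + k) x
  = iter_derive vs f x + (if vs is [::] then k else 0).
Proof.
case: vs => // v vs; rewrite addr0 lastI -cats1 !iter_derive_cat.
have -> // : iter_derive [:: last v vs] (fun x => f x + k) =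
  iter_derive [:: last v vs] f by exact: derive_addcst.
Qed.

Lemma smooth_open_addcst {V W : normedModType R} (O : set V) (f : V -> W)
    (k : W) :
  smooth_open O f -> smooth_open O (fun x => f x + k).
Proof.
move=> sf vs x Ox; have [cf df] := sf vs x Ox.
have -> : iter_derive vs (fun x => f x + k) =
    iter_derive vs f + cst (if vs is [::] then k else 0).
  by apply/funext => y; rewrite iter_derive_addcst.
split; first by apply: continuousD => //; exact: cst_continuous.
by move=> v; apply: derivableD => //; exact: derivable_cst.
Qed.

Lemma derive_invariant {V W : normedModType R} (f : V -> W) (s v x : V) :
  (forall y, f (y + s) = f y) -> 'D_v f (x + s) = 'D_v f x.
Proof.
move=> fs; rewrite /derive.
rewrite (_ : (fun h : R => _) =
  fun h => h^-1 *: ((f \o shift x) (h *: v) - f x))//.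
by apply/funext => h /=; rewrite addrA !fs.
Qed.

End Translations.

(** * Smooth functions of one variable *)

Section OneVariable.
Context {R : realType}.

Lemma is_derive1_dir (f : R -> R) (x v a : R) :
  is_derive x 1 f a -> is_derive x v f (a * v).
Proof.
by move=> df; exact: (@is_derive_comp1 R R f id x v a v).
Qed.

Lemma is_derive1_continuous (f : R -> R) (x a : R) :
  is_derive x 1 f a -> {for x, continuous f}.
Proof.
move=> [df _]; apply: differentiable_continuous.
exact/derivable1_diffP.
Qed.

Lemma smooth_open_primitive1 (O : set R) (f g : R -> R) : open O ->
  smooth_open O g -> (forall x, O x -> is_derive x 1 f (g x)) ->
  smooth_open O f.
Proof.
move=> oO sg fg; apply: smooth_open_primitive => //.
  by move=> x /fg; exact: is_derive1_continuous.
move=> v; exists (fun x => g x * v); last first.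
  by move=> x /fg; exact: is_derive1_dir.
by apply: smooth_openM => //; exact: smooth_open_cst.
Qed.

(** The finite linear combinations of the family form a class stable under
differentiation, to which [smooth_open_class] applies. *)
Lemma smooth_open_family (I : Type) (O : set R) (F : I -> R -> R)
    (D : I -> seq (R * I)) : open O ->
  (forall i x, O x -> is_derive x 1 (F i) (\sum_(e <- D i) e.1 * F e.2 x)) ->
  forall i, smooth_open O (F i).
Proof.
move=> oO dF i.
pose C : set (R -> R) :=
  [set h | exists s : seq (R * I), h = fun x => \sum_(e <- s) e.1 * F e.2 x].
have dC s x : O x -> is_derive x 1 (fun x => \sum_(e <- s) e.1 * F e.2 x)
    (\sum_(e <- s) e.1 * \sum_(e' <- D e.2) e'.1 * F e'.2 x).
  move=> Ox; elim: s => [|e s IH].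
    under eq_fun do rewrite big_nil.
    by rewrite big_nil; exact: is_derive_cst.
  under eq_fun do rewrite big_cons.
  rewrite big_cons; apply: is_deriveD.
  have := @is_deriveZ _ _ _ (F e.2) e.1 x 1 _ (dF e.2 x Ox).
  by [].
apply: (@smooth_open_class _ _ _ O C) => //.
- by move=> _ [s ->] x Ox; exact: is_derive1_continuous (dC s x Ox).
- move=> _ [s ->] v.
  pose s' := flatten [seq [seq (v * e.1 * e'.1, e'.2) | e' <- D e.2] | e <- s].
  exists (fun x => \sum_(e <- s') e.1 * F e.2 x); first by exists s'.
  move=> x Ox; have := is_derive1_dir v (dC s x Ox).
  congr is_derive; rewrite big_flatten big_map big_distrl /=.
  apply: eq_bigr => e _; rewrite big_map big_distrr /= big_distrl /=.
  by apply: eq_bigr => e' _; rewrite /=; ring.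
- exists [:: (1, i)]; apply/funext => x.
  by rewrite big_seq1 mul1r.
Qed.

Lemma smooth_trigo (b : bool) : smooth_open setT (if b then @sin R else @cos R).
Proof.
apply: (@smooth_open_family bool setT (fun b => if b then @sin R else @cos R)
  (fun b => if b then [:: (1, false)] else [:: (-1, true)])).
  exact: openT.
move=> [] x _; rewrite big_seq1 /=.
  by rewrite mul1r; exact: is_derive_sin.
by rewrite mulN1r; exact: is_derive_cos.
Qed.

Lemma smooth_sin : smooth_open setT (@sin R).
Proof. exact: (smooth_trigo true). Qed.

Lemma smooth_cos : smooth_open setT (@cos R).
Proof. exact: (smooth_trigo false). Qed.

Lemma open_neq0 : open [set x : R | x != 0].
Proof.
rewrite (_ : [set x : R | x != 0] = ~` [set 0]); last first.
  by apply/seteqP; split => x /eqP.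
by apply: closed_openC; exact: closed_eq.
Qed.

Lemma smooth_inv : smooth_open [set x : R | x != 0] (@GRing.inv R).
Proof.
have -> : @GRing.inv R = fun x => x^-1 ^+ 1 by apply/funext => x; rewrite expr1.
apply: (@smooth_open_family nat [set x : R | x != 0] (fun k x => x^-1 ^+ k)
  (fun k => [:: (- k%:R, k.+1)])).
  exact: open_neq0.
move=> k x /= x0; rewrite big_seq1 /=.
have dV : is_derive x 1 (@GRing.inv R) (- x ^- 2).
  have := @is_deriveV R id x 1 1 x0 (is_derive_id _ _).
  by rewrite /= [_ *: 1]mulr1.
have := @is_deriveX R R (@GRing.inv R) k x 1 _ dV.
congr is_derive; first by apply/funext => y; rewrite fctE.
case: k => [|k]; first by rewrite mulr0n oppr0 !mul0r scale0r.
rewrite /GRing.scale /= -!exprVn mulrN !mulNr; congr (- _).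
by rewrite -mulrA -exprD addn2.
Qed.

Lemma smooth_ln : smooth_open [set x : R | 0 < x] (@ln R).
Proof.
have dln (x : R) : 0 < x -> is_derive x 1 (@ln R) x^-1 by exact: is_derive1_ln.
apply: (smooth_open_primitive1 _ _ dln); first exact: open_gt.
by apply: smooth_openS smooth_inv => x /= /lt0r_neq0.
Qed.

Lemma smooth_atan : smooth_open setT (@atan R).
Proof.
have datan (x : R) : setT x -> is_derive x 1 (@atan R) (1 + x ^+ 2)^-1.
  by move=> _; exact: is_derive1_atan.
apply: (smooth_open_primitive1 _ _ datan); first exact: openT.
apply: (smooth_open_comp (U := [set x | x != 0])); first exact: openT.
- exact: smooth_inv.
- apply: smooth_openD; first exact: openT.
    by apply: smooth_open_cst; exact: openT.
  apply: smooth_openX; first exact: openT.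
  by apply: smooth_open_id; exact: openT.
- by move=> x _ /=; rewrite lt0r_neq0// ltr_wpDr// sqr_ge0.
Qed.

(** [y^-k e^(-1/y) cos (w/y + a)] for [i = (k, a)], extended by zero.  The index
[i] ranges over what is needed for closure under differentiation; the frequency
[w] is 0 for plain cut-offs and 1 for the oscillation of the spiral. *)
Definition flat (w : R) (i : nat * R) (y : R) : R :=
  if 0 < y then y^-1 ^+ i.1 * expR (- y^-1) * cos (w * y^-1 + i.2) else 0.

(** [z / m <= e^(z / m)], raised to the power [m]. *)
Lemma expR_decay m (z : R) : 0 < z -> z ^+ m * expR (- z) <= m%:R ^+ m.
Proof.
case: m => [|m] z0.
  by rewrite !expr0 mul1r -expR0 ler_expR oppr_le0 ltW.
have m0 : 0 < m.+1%:R :> R by rewrite ltr0n.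
have le : (z / m.+1%:R) ^+ m.+1 <= expR z.
  have -> : expR z = expR (z / m.+1%:R) ^+ m.+1.
    by rewrite -expRM_natl -[m.+1%:R * _]mulrC divfK// gt_eqF.
  apply: lerXn2r; rewrite ?nnegrE ?expR_ge0 ?divr_ge0 ?ltW//.
  by apply: lt_le_trans (expR_ge1Dx _); rewrite ltrDr.
rewrite expRN -ler_pdivlMr ?invr_gt0 ?expR_gt0// invrK mulrC.
by move: le; rewrite expr_div_n ler_pdivrMr ?exprn_gt0// .
Qed.

Lemma flat_bound w i y : `|flat w i y| <= i.1.+2%:R ^+ i.1.+2 * y ^+ 2.
Proof.
rewrite /flat; case: ifP => y0; last first.
  by rewrite normr0 mulr_ge0// ?sqr_ge0// exprn_ge0// ler0n.
rewrite !normrM; apply: (@le_trans _ _ (y^-1 ^+ i.1 * expR (- y^-1) * 1)).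
  rewrite [`|expR _|]ger0_norm ?expR_ge0//.
  rewrite [`|_ ^+ _|]ger0_norm ?exprn_ge0 ?invr_ge0 ?(ltW y0)//.
  apply: ler_wpM2l.
    by rewrite mulr_ge0 ?expR_ge0 ?exprn_ge0 ?invr_ge0 ?(ltW y0).
  by rewrite ler_norml cos_geN1 cos_le1.
have := @expR_decay i.1.+2 y^-1; rewrite invr_gt0 => /(_ y0) le.
rewrite mulr1 -ler_pdivrMr ?exprn_gt0//; apply: le_trans le.
by rewrite -(addn2 i.1) exprD -exprVn mulrAC.
Qed.

Lemma flat0 w i : flat w i 0 = 0.
Proof. by rewrite /flat ltxx. Qed.

(** The decay of the exponential makes the function [O(y^2)]. *)
Lemma is_derive_flat0 (w : R) (i : nat * R) : is_derive (0 : R) 1 (flat w i) 0.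
Proof.
have cvgl : h^-1 *: (((flat w i) \o shift 0) (h *: (1 : R)) - flat w i 0)
    @[h --> 0^'] --> (0 : R).
  apply/cvgr0Pnorm_lt => e e0.
  set M := i.1.+2%:R ^+ i.1.+2 : R.
  have M0 : 0 < M by rewrite exprn_gt0// ltr0n.
  near=> h.
  have h0 : h != 0 by near: h; exact: nbhs_dnbhs_neq.
  rewrite /= addr0 flat0 subr0 [h *: 1]mulr1 normrZ normfV.
  rewrite mulrC ltr_pdivrMr ?normr_gt0//.
  apply: le_lt_trans (flat_bound _ _ _) _.
  rewrite -/M -real_normK ?num_real// expr2 mulrA ltr_pM2r ?normr_gt0//.
  rewrite -ltr_pdivlMl//; near: h.
  by apply: dnbhs0_lt; rewrite mulr_gt0// invr_gt0.
by apply: DeriveDef; [apply/cvg_ex; exists 0|exact: cvg_lim].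
Unshelve. all: by end_near. Qed.

Lemma smooth_flat (w : R) (i : nat * R) : smooth_open setT (flat w i).
Proof.
pose D (i : nat * R) := [:: (- i.1%:R, (i.1.+1, i.2)); (1, (i.1.+2, i.2));
                            (w, (i.1.+2, i.2 - pi / 2))].
apply: (@smooth_open_family _ setT (flat w) D); first exact: openT.
(* The only point where the derivative is not given by the usual rules is 0. *)
move=> {}i x _; rewrite !big_cons big_nil addr0 /=.
have [x0|x0|->] := ltgtP x 0.
- have -> : - i.1%:R * flat w (i.1.+1, i.2) x +
      (1 * flat w (i.1.+2, i.2) x + w * flat w (i.1.+2, i.2 - pi / 2) x) = 0.
    by rewrite /flat ltNge (ltW x0) !mulr0 !addr0.
  have : is_derive x 1 (cst 0 : R -> R) 0 by exact: is_derive_cst.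
  apply: near_eq_is_derive; near=> y; rewrite /flat ifF//; apply/negbTE.
  by rewrite -leNgt ltW//; near: y; exact: lt_nbhsl.
- have dV : is_derive x 1 (@GRing.inv R) (- x ^- 2).
    have := @is_deriveV R id x 1 1 (lt0r_neq0 x0) (is_derive_id _ _).
    by rewrite /= [_ *: 1]mulr1.
  have dX := @is_deriveX R R (@GRing.inv R) i.1 x 1 _ dV.
  have dN : is_derive x 1 (fun y : R => - y^-1) (- (- x ^- 2)).
    exact: is_deriveN.
  have dE := @is_derive1_comp R expR _ x _ _ (is_derive_expR _) dN.
  have dC : is_derive x 1 (fun y : R => w * y^-1 + i.2) (w * (- x ^- 2) + 0).
    apply: is_deriveD; exact: (@is_deriveZ _ _ _ _ w).
  have dcos := @is_derive1_comp R (@cos R) _ x _ _ (is_derive_cos _) dC.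
  have dXE := @is_deriveM R R _ _ x 1 _ _ dX dE.
  have dall := @is_deriveM R R _ _ x 1 _ _ dXE dcos.
  have eqd := near_eq_is_derive _ dall.
  have := eqd (flat w i); rewrite /= => {}eqd.
  have near_eq : \forall y \near x, ((@GRing.inv R) ^+ i.1
      * (expR \o (fun y : R => - y^-1))
      * (@cos R \o (fun y => w * y^-1 + i.2))) y = flat w i y.
    near=> y; rewrite /flat ifT; last by near: y; exact: lt_nbhsr.
    by rewrite /= !fctE.
  have := eqd near_eq; congr is_derive.
  rewrite /flat x0 /GRing.scale /= !fctE /= (addrA (w * x^-1)) cosBpihalf.
  rewrite -!exprVn.
  set c := cos _; set s := sin _; set e := expR _; set z := x^-1.
  by case: (i.1) => [|k] /=; rewrite ?mulr0n ?exprS; ring.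
- rewrite !flat0 !mulr0 !addr0; exact: is_derive_flat0.
Unshelve. all: by end_near. Qed.

End OneVariable.

(** * Tori as quotients by period lattices *)

Section AffineMaps.
Context {R : realType} {n : nat}.
Local Notation E := 'rV[R]_n.

Lemma translation_continuous (v : E) : continuous (fun x : E => x + v).
Proof.
by move=> x; exact: (continuousD (f := id) (g := cst v) (@cvg_id _ _)
  (@cst_continuous _ _ _ _)).
Qed.

Lemma near_affine_partial m (f : E -> 'rV[R]_m) (A : 'M[R]_(n, m))
    (k : 'rV[R]_m) (x : E) (i : 'I_n) :
  (\forall y \near x, f y = y *m A + k) ->
  \forall y \near x, partial i f y = row i A.
Proof.
move=> fA; apply: filterS (nbhs_interior fA) => y {}fA.
have -> : partial i f y = partial i (fun y => y *m A + k) y.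
  exact: near_eq_derive.
have [_ dA] := is_derive_affine (mulmxr A) k y (delta_mx 0 i).
by rewrite rowE; exact: dA.
Qed.

Lemma near_affine_dmx m (f : E -> 'rV[R]_m) (A : 'M[R]_(n, m))
    (k : 'rV[R]_m) (x : E) :
  (\forall y \near x, f y = y *m A + k) -> \forall y \near x, dmx f y = A.
Proof.
move=> fA.
have : \forall y \near x, forall i, partial i f y = row i A.
  have := @filter_forall E 'I_n (fun i y => partial i f y = row i A) (nbhs x).
  by apply => i; exact: near_affine_partial fA.
apply: filterS => y dfA; apply/matrixP => i j.
by rewrite mxE dfA mxE.
Qed.

End AffineMaps.

(** Full-rank lattices, up to scaling: the bound 1 in [periods_discrete] makes
balls of radius 1/2 embed into the quotient. *)
Record periodLattice (R : realType) (n : nat) := PeriodLattice {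
  periods : set 'rV[R]_n ;
  periods0 : periods 0 ;
  periodsB : forall v w, periods v -> periods w -> periods (v - w) ;
  periods_discrete : forall v, periods v -> `|v| < 1 -> v = 0 ;
  periods_cocompact : exists2 K : set 'rV[R]_n, compact K &
    forall x, exists2 v, periods v & K (x - v)
}.

Section QuotientTorus.
Context {R : realType} {n : nat} (L : periodLattice R n).
Local Notation E := 'rV[R]_n.
Local Open Scope quotient_scope.

Lemma periodsN v : periods L v -> periods L (- v).
Proof.
by move=> Lv; rewrite -[- v]add0r; apply: periodsB => //; exact: periods0.
Qed.

Lemma periodsD v w : periods L v -> periods L w -> periods L (v + w).
Proof.
by move=> Lv Lw; rewrite -[w]opprK; apply: periodsB => //; exact: periodsN.
Qed.

Definition period_rel : rel E := fun x y => `[< periods L (x - y) >].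

Lemma period_rel_refl : reflexive period_rel.
Proof. by move=> x; apply/asboolP; rewrite subrr; exact: periods0. Qed.

Lemma period_rel_sym : symmetric period_rel.
Proof.
by move=> x y; apply/asboolP/asboolP => /periodsN; rewrite opprB.
Qed.

Lemma period_rel_trans : transitive period_rel.
Proof.
move=> y x z /asboolP xy /asboolP yz; apply/asboolP.
by rewrite -(subrKA y); exact: periodsD.
Qed.

Definition period_equiv : equiv_rel E :=
  EquivRel period_rel period_rel_refl period_rel_sym period_rel_trans.

Definition qtorus : topologicalType := quotient_topology {eq_quot period_equiv}.

Definition qproj (x : E) : qtorus :=
  \pi_(quotient_topology {eq_quot period_equiv}) x.

Lemma qprojP x y : qproj x = qproj y <-> periods L (x - y).
Proof.
split => [/eqmodP/asboolP //|Lxy].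
by apply/eqmodP/asboolP.
Qed.

Lemma qprojD x v : periods L v -> qproj (x + v) = qproj x.
Proof. by move=> Lv; apply/qprojP; rewrite addrAC subrr add0r. Qed.

Lemma qproj_surj (y : qtorus) : exists x, qproj x = y.
Proof. by exists (repr y); rewrite /qproj reprK. Qed.

Lemma qproj_continuous : continuous qproj.
Proof. exact: pi_continuous. Qed.

Lemma qproj_open (W : set E) : open W -> open (qproj @` W).
Proof.
move=> oW; suff : open (qproj @^-1` (qproj @` W)) by [].
rewrite (_ : _ @^-1` _ = \bigcup_(v in periods L) (fun x => x + v) @^-1` W).
  apply: bigcup_open => v _; apply: open_comp => // x _.
  exact: translation_continuous.
apply/seteqP; split => x /=.
  by move=> [w Ww /qprojP Lwx]; exists (w - x) => //=; rewrite addrC subrK.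
by move=> [v Lv Wxv]; exists (x + v) => //; exact: qprojD.
Qed.

Lemma qtorus_compact : compact [set: qtorus].
Proof.
have [K cK KL] := periods_cocompact L.
rewrite (_ : setT = qproj @` K).
  apply: continuous_compact => //; apply: continuous_subspaceT.
  exact: qproj_continuous.
apply/seteqP; split => // y _; have [x <-] := qproj_surj y.
have [v Lv Kxv] := KL x; exists (x - v) => //.
by apply: qprojD; exact: periodsN.
Qed.

(** Two lattice points close to [x] differ by a short period, so at most one
lattice point is within 1/2 of [x]; this makes the lattice closed, hence the
quotient Hausdorff. *)
Lemma periods_separated x : ~ periods L x ->
  exists2 e : R, 0 < e & forall v, periods L v -> e <= `|x - v|.
Proof.
move=> nLx.
have [[v [Lv vx]]|far] := pselect (exists v, periods L v /\ `|x - v| < 2^-1).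
- have xv0 : 0 < `|x - v|.
    rewrite normr_gt0 subr_eq0; apply/eqP => xv; by apply: nLx; rewrite xv.
  exists `|x - v| => // w Lw; rewrite leNgt; apply/negP => xw.
  suff vw : v = w by move: xw; rewrite vw ltxx.
  apply/eqP; rewrite -subr_eq0; apply/eqP; apply: (@periods_discrete _ _ L).
    exact: periodsB.
  rewrite -(subrKA x) (le_lt_trans (ler_normD _ _))// distrC.
  by have := lt_trans xw vx; lra.
- exists 2^-1; first by rewrite invr_gt0.
  by move=> v Lv; rewrite leNgt; apply/negP => vx; apply: far; exists v.
Qed.

Lemma qtorus_hausdorff : hausdorff_space qtorus.
Proof.
rewrite open_hausdorff => y y'.
have [x <-] := qproj_surj y; have [x' <-] := qproj_surj y' => /eqP xx'.
have nL : ~ periods L (x - x') by move=> /qprojP.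
have [e e0 far] := periods_separated nL.
have e20 : 0 < e / 2 by rewrite divr_gt0.
exists (qproj @` ball x (e / 2), qproj @` ball x' (e / 2)); rewrite /=.
  by split; apply/mem_set; [exists x|exists x'] => //; exact: ballxx.
split; [exact/qproj_open/ball_open|exact/qproj_open/ball_open|].
apply/eqP/seteqP; split => // _ [[w xw <-] [w' xw' /qprojP Lw]] /=.
have Lww : periods L (w - w') by rewrite -opprB; exact: periodsN.
have := far _ Lww; rewrite leNgt => /negP; apply.
move: xw xw'; rewrite -!ball_normE /= => xw xw'.
rewrite (_ : x - x' - _ = (x - w) - (x' - w')); last first.
  by rewrite !opprB addrACA [in RHS]addrACA [- x' - w]addrC.
by rewrite (le_lt_trans (ler_normB _ _))// [ltRHS]splitr ltrD.
Qed.

(** The charts are indexed by their centre [q]: they lift the projection of the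
ball of radius 1/2 about [q] back to that ball. *)
Definition tdom (q : E) : set qtorus := qproj @` ball q 2^-1.

Definition tchart (q : E) (y : qtorus) : E :=
  xget q [set x | ball q 2^-1 x /\ qproj x = y].

Lemma tchart_proj q x : ball q 2^-1 x -> tchart q (qproj x) = x.
Proof.
move=> qx; rewrite /tchart.
case: xgetP => [w _ /= [qw /qprojP Lwx]|]; last by move=> /(_ x) /=; case.
apply/eqP; rewrite -subr_eq0; apply/eqP.
apply: (@periods_discrete _ _ L) => //.
move: qw qx; rewrite -!ball_normE /= => qw qx.
rewrite -(subrKA q) (le_lt_trans (ler_normD _ _))// [`|w - q|]distrC.
lra.
Qed.

Lemma qprojK q y : tdom q y -> qproj (tchart q y) = y.
Proof. by move=> [x qx <-]; rewrite tchart_proj. Qed.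

Lemma tchart_ball q y : tdom q y -> ball q 2^-1 (tchart q y).
Proof. by move=> [x qx <-]; rewrite tchart_proj. Qed.

Lemma tchart_image q : tchart q @` tdom q = ball q 2^-1.
Proof.
apply/seteqP; split => [_ [y qy <-]|x qx]; first exact: tchart_ball.
by exists (qproj x); [exists x|exact: tchart_proj].
Qed.

(** A chart undoes the projection up to a period, which is locally constant
because the periods are discrete.  Computations in charts thus reduce to
computations in R^n. *)
Lemma tchart_proj_near q x : tdom q (qproj x) -> exists2 v, periods L v &
  \forall y \near x, ball q 2^-1 (y + v) /\ tchart q (qproj y) = y + v.
Proof.
move=> qx; exists (tchart q (qproj x) - x).
  by apply/qprojP; exact: qprojK.
set v := _ - x; have Lv : periods L v by apply/qprojP; exact: qprojK.
have near_ball : \forall y \near x, ball q 2^-1 (y + v).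
  have cv : (fun y : E => y + v) @ x --> x + v.
    exact: translation_continuous.
  apply: cv; apply: open_nbhs_nbhs; split; first exact: ball_open.
  by rewrite addrC subrK; exact: tchart_ball.
apply: filterS near_ball => y qy; split => //.
by rewrite -(qprojD y Lv) tchart_proj.
Qed.

Lemma tchart_continuous q y : tdom q y -> {for y, continuous (tchart q)}.
Proof.
move=> qy; have [x xy] := qproj_surj y; rewrite -xy in qy *.
have qx := tchart_ball qy.
move=> A /=; rewrite nbhsE => -[B [oB Bx] BA].
have nbB : nbhs (qproj x) (qproj @` (B `&` ball q 2^-1)).
  apply: open_nbhs_nbhs; split.
    by apply: qproj_open; apply: openI => //; exact: ball_open.
  by exists (tchart q (qproj x)) => //; exact: qprojK.
apply: filterS nbB => _ [w [Bw qw] <-].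
by rewrite /= tchart_proj//; exact: BA.
Qed.

Lemma tchart_transition_smooth p q :
  smooth_open (tchart p @` (tdom p `&` tdom q)) (tchart q \o qproj).
Proof.
apply: smooth_open_local => _ [y [py qy] <-].
have [v Lv nearv] : exists2 v, periods L v & \forall z \near tchart p y,
    ball q 2^-1 (z + v) /\ tchart q (qproj z) = z + v.
  by apply: tchart_proj_near; rewrite qprojK.
exists [set z | tchart q (qproj z) = z + v], (fun z => z + v); split => //.
  by apply: filterS nearv => z [].
apply: (@smooth_openS _ _ _ _ setT) => //; apply: smooth_open_addcst.
exact: smooth_open_id openT.
Qed.

Variable G : E -> 'M[R]_n.
Hypothesis Gsmooth : smooth_open setT G.
Hypothesis Gposdef : forall x, posdef (G x).
Hypothesis Gperiodic : forall x v, periods L v -> G (x + v) = G x.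

Lemma tmetric_transition p q y : tdom p y -> tdom q y ->
  G (tchart p y) = pullback (tchart q \o qproj) G (tchart p y).
Proof.
move=> py qy; rewrite /pullback /= qprojK//.
have [v Lv nearv] : exists2 v, periods L v & \forall z \near tchart p y,
    ball q 2^-1 (z + v) /\ tchart q (qproj z) = z + v.
  by apply: tchart_proj_near; rewrite qprojK.
have aff : \forall z \near tchart p y, (tchart q \o qproj) z = z *m 1%:M + v.
  by apply: filterS nearv => z [_ ?]; rewrite mulmx1.
rewrite (nbhs_singleton (near_affine_dmx aff)) mul1mx trmx1 mulmx1.
have [_] := nbhs_singleton nearv; rewrite qprojK// => ->.
by rewrite Gperiodic.
Qed.

Definition riemannian_torus : closedRiemannian R n.
Proof.
apply: (@ClosedRiemannian R n qtorus E tdom tchart (fun=> qproj) (fun=> G)).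
- exact: qtorus_compact.
- exact: qtorus_hausdorff.
- move=> y; have [x <-] := qproj_surj y; exists x, x => //.
  by apply: ballxx; rewrite invr_gt0.
- by move=> q; apply: qproj_open; exact: ball_open.
- by move=> q; rewrite tchart_image; exact: ball_open.
- exact: qprojK.
- exact: tchart_continuous.
- by move=> q p _; exact: qproj_continuous.
- exact: tchart_transition_smooth.
- by move=> q; exact: smooth_openS Gsmooth.
- by move=> q y _; exact: Gposdef.
- exact: tmetric_transition.
Defined.

End QuotientTorus.

Section BoxLattice.
Context {R : realType} {n : nat} (l : 'I_n -> R).
Hypothesis l_ge1 : forall j, 1 <= l j.

Definition box_periods : set 'rV[R]_n :=
  [set v | forall j, exists k : int, v 0 j = k%:~R * l j].

Lemma norm_coord_le (v : 'rV[R]_n) j : `|v 0 j| <= `|v|.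
Proof.
rewrite [leRHS]/Num.Def.normr/= mx_normrE.
exact: (le_bigmax _ (fun ij : 'I_1 * 'I_n => `|v ij.1 ij.2|) (0, j)).
Qed.

Definition box_lattice : periodLattice R n.
Proof.
apply: (@PeriodLattice R n box_periods).
- by move=> j; exists 0; rewrite mxE mul0r.
- move=> v w Lv Lw j; have [k vk] := Lv j; have [m wm] := Lw j.
  by exists (k - m); rewrite !mxE vk wm rmorphB mulrBl.
- move=> v Lv v1; apply/rowP => j; rewrite mxE; have [k vk] := Lv j.
  have := le_lt_trans (norm_coord_le v j) v1; rewrite vk.
  have [->|k0] := eqVneq k 0; first by rewrite mul0r.
  have k1 : 1 <= `|k%:~R : R|.
    by rewrite -intr_norm ler1z; case: (k) k0 => [[]|].
  rewrite normrM [X in _ * X]ger0_norm ?(le_trans ler01)// ltNge => /negP[].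
  by rewrite -[leLHS]mulr1 ler_pM.
- exists [set v | forall j, v ord0 j \in `[0, l j]].
    apply: (@rV_compact _ _ (fun j => `[0, l j]%classic)) => j.
    exact: segment_compact.
  move=> x; have l0 j : 0 < l j := lt_le_trans ltr01 (l_ge1 j).
  exists (\row_j ((Num.floor (x 0 j / l j))%:~R * l j)).
    by move=> j; exists (Num.floor (x 0 j / l j)); rewrite mxE.
  move=> j; rewrite !mxE in_itv /=; apply/andP; split.
    by rewrite subr_ge0 -ler_pdivlMr// floor_le.
  rewrite lerBlDr -[X in X + _]mul1r -mulrDl -ler_pdivrMr// addrC.
  rewrite -[1]/(1%:~R) -intrD ltW// ?floorD1_gt//.
Defined.

End BoxLattice.

(** * The warping function *)

Section Potential.
Context {R : realType}.
Implicit Types x y th : R.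

Definition bump (y : R) : R := flat 0 (0%N, 0) y.

Lemma bump_gt0E y : 0 < y -> bump y = expR (- y^-1).
Proof.
by move=> y0; rewrite /bump /flat y0 /= mul0r addr0 cos0 mulr1 mul1r.
Qed.

Lemma bump_le0 y : y <= 0 -> bump y = 0.
Proof. by rewrite /bump /flat ltNge => ->. Qed.

Lemma bump_ge0 y : 0 <= bump y.
Proof.
have [y0|y0] := leP y 0; first by rewrite bump_le0.
by rewrite bump_gt0E// expR_ge0.
Qed.

Lemma sin2_le1 x : sin x ^+ 2 <= 1.
Proof. by rewrite -(cos2Dsin2 x) lerDr sqr_ge0. Qed.

(** The bump is a cut-off away from [sin^2 x <= 1/2]: it leaves [f] unchanged
there and keeps it positive elsewhere. *)
Lemma with_bump_gt0 x (f : R) :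
  0 <= f -> (sin x ^+ 2 <= 2^-1 -> 0 < f) -> 0 < f + bump (sin x ^+ 2 - 2^-1).
Proof.
move=> f0 fpos; have [s|s] := leP (sin x ^+ 2) 2^-1.
  by rewrite ltr_wpDr ?bump_ge0 ?fpos.
by rewrite ltr_wpDl// bump_gt0E ?subr_gt0// expR_gt0.
Qed.

(** Near the critical circle [x = 0] this is [tan x]; the bump in the
denominator only serves to define it, smooth and periodic, for all [x]. *)
Definition height x : R :=
  sin x * cos x / (cos x ^+ 2 + bump (sin x ^+ 2 - 2^-1)).

(** The choice for which the gradient of [warping] is tangent to the spiral
[th = 1 / tan x] for the metric [dx^2 + fibre_metric dth^2], in the region
[sin^2 x <= 1/2]. *)
Definition amplitude x : R := 1 - sin x ^+ 4.

Definition fibre_metric x : R := amplitude x + bump (sin x ^+ 2 - 2^-1).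

(** [1 + e^(-1/r) (1 - c sin (th - 1/r))] with [r = height x] and
[c = amplitude x], extended by 1 for [r <= 0].  The sine is expanded by the
addition formula so that [r] enters through smooth functions on R only. *)
Definition warping x th : R :=
  1 + bump (height x)
  - amplitude x * (sin th * flat 1 (0%N, 0) (height x)
                   - cos th * flat 1 (0%N, - (pi / 2)) (height x)).

Lemma height_den_gt0 x : 0 < cos x ^+ 2 + bump (sin x ^+ 2 - 2^-1).
Proof.
apply: with_bump_gt0; first exact: sqr_ge0.
rewrite cos2sin2 => s; apply: lt_le_trans (lerB (lexx _) s).
by rewrite subr_gt0; lra.
Qed.

Lemma amplitude_itv x : 0 <= amplitude x <= 1.
Proof.
rewrite /amplitude (exprM _ 2 2) lerBlDr lerDl sqr_ge0 andbT subr_ge0.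
by rewrite -(expr1n _ 2) lerXn2r ?nnegrE ?sqr_ge0// sin2_le1.
Qed.

Lemma fibre_metric_gt0 x : 0 < fibre_metric x.
Proof.
have /andP[a0 _] := amplitude_itv x; apply: with_bump_gt0 => // s.
rewrite /amplitude (exprM _ 2 2) subr_gt0.
rewrite (@le_lt_trans _ _ (2^-1 ^+ 2))//; last by rewrite expr2; lra.
by rewrite lerXn2r ?nnegrE ?sqr_ge0//; lra.
Qed.

Lemma warping_gt0E x th : 0 < height x ->
  warping x th = 1 + expR (- (height x)^-1)
                 * (1 - amplitude x * sin (th - (height x)^-1)).
Proof.
move=> r0; rewrite /warping bump_gt0E// /flat r0 /= !mul1r cosBpihalf addr0.
rewrite sinB; ring.
Qed.

Lemma warping_le0E x th : height x <= 0 -> warping x th = 1.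
Proof.
move=> r0; rewrite /warping bump_le0// /flat ltNge r0 /=.
by rewrite !mulr0 subrr mulr0 subr0 addr0.
Qed.

Lemma warping_ge1 x th : 1 <= warping x th.
Proof.
have [r0|r0] := leP (height x) 0; first by rewrite warping_le0E.
rewrite warping_gt0E// lerDl mulr_ge0 ?expR_ge0// subr_ge0.
have /andP[a0 a1] := amplitude_itv x.
by rewrite (le_trans (ler_wpM2l a0 (sin_le1 _)))// mulr1.
Qed.

Lemma sin_period k x : sin (x + k%:~R * (pi *+ 2)) = sin x.
Proof.
have nat_period m y : sin (y + m%:R * (pi *+ 2)) = sin y.
  by rewrite mulr_natl; apply: periodicn; exact: sinD2pi.
case: k => m; first exact: nat_period.
rewrite NegzE -[in RHS](subrK (m.+1%:R * (pi *+ 2)) x) nat_period.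
by rewrite mulrNz mulNr.
Qed.

Lemma cos_period k x : cos (x + k%:~R * (pi *+ 2)) = cos x.
Proof. by rewrite -!sinDpihalf addrAC sin_period. Qed.

Lemma height_period k x : height (x + k%:~R * (pi *+ 2)) = height x.
Proof. by rewrite /height sin_period cos_period. Qed.

Lemma warping_period k l x th :
  warping (x + k%:~R * (pi *+ 2)) (th + l%:~R * (pi *+ 2)) = warping x th.
Proof.
by rewrite /warping /amplitude height_period !sin_period cos_period.
Qed.

Lemma fibre_metric_period k x :
  fibre_metric (x + k%:~R * (pi *+ 2)) = fibre_metric x.
Proof. by rewrite /fibre_metric /amplitude sin_period. Qed.

Section Smooth.
Context {V : normedModType R} (O : set V) (oO : open O) (f g : V -> R).
Hypotheses (sf : smooth_open O f) (sg : smooth_open O g).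

Lemma smooth_total (phi : R -> R) (h : V -> R) : smooth_open setT phi ->
  smooth_open O h -> smooth_open O (fun p => phi (h p)).
Proof. by move=> sphi sh; exact: (smooth_open_comp oO sphi sh). Qed.

Let scst (k : R) : smooth_open O (fun=> k) := smooth_open_cst k oO.

Lemma smooth_sin2_bump : smooth_open O (fun p => bump (sin (f p) ^+ 2 - 2^-1)).
Proof.
have ss := smooth_total smooth_sin sf.
exact: (smooth_total (smooth_flat _ _)
  (smooth_openB oO (smooth_openX 2 oO ss) (scst 2^-1))).
Qed.

Lemma smooth_height : smooth_open O (fun p => height (f p)).
Proof.
have ss := smooth_total smooth_sin sf.
have sc := smooth_total smooth_cos sf.
have sden := smooth_openD oO (smooth_openX 2 oO sc) smooth_sin2_bump.
have sV := smooth_open_comp oO smooth_inv sden.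
apply: (smooth_openM oO (smooth_openM oO ss sc)); apply: sV.
by move=> p _ /=; rewrite lt0r_neq0// height_den_gt0.
Qed.

Lemma smooth_amplitude : smooth_open O (fun p => amplitude (f p)).
Proof.
exact: (smooth_openB oO (scst 1)
  (smooth_openX 4 oO (smooth_total smooth_sin sf))).
Qed.

Lemma smooth_fibre_metric : smooth_open O (fun p => fibre_metric (f p)).
Proof. exact: (smooth_openD oO smooth_amplitude smooth_sin2_bump). Qed.

Lemma smooth_warping : smooth_open O (fun p => warping (f p) (g p)).
Proof.
have ss := smooth_total smooth_sin sg.
have sc := smooth_total smooth_cos sg.
have sh w i := smooth_total (smooth_flat w i) smooth_height.
apply: (smooth_openB oO (smooth_openD oO (scst 1) (sh 0 (0%N, 0)))).
apply: (smooth_openM oO smooth_amplitude).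
exact: (smooth_openB oO (smooth_openM oO ss (sh _ _))
  (smooth_openM oO sc (sh _ _))).
Qed.

End Smooth.

Lemma height_tan x : sin x ^+ 2 <= 2^-1 -> height x = sin x / cos x.
Proof.
move=> s; rewrite /height bump_le0 ?subr_le0// addr0.
have c0 : cos x != 0.
  rewrite -sqrf_eq0 cos2sin2 gt_eqF// subr_gt0 (le_lt_trans s)//; lra.
by rewrite expr2 invfM mulrA mulfK.
Qed.

(** The circle [x = 0] is critical because [warping] is flat in [height x]. *)
Lemma is_derive_warping_crit_x th : is_derive (0 : R) 1 (warping^~ th) 0.
Proof.
have h0 : height 0 = 0 by rewrite /height sin0 !mul0r.
have dh : is_derive (0 : R) 1 height ('D_1 height 0).
  apply: derivableP.
  apply: (@smooth_open_derivable _ _ _ setT) => //.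
  exact: (smooth_height openT (smooth_open_id openT)).
have da : is_derive (0 : R) 1 amplitude ('D_1 amplitude 0).
  apply: derivableP.
  apply: (@smooth_open_derivable _ _ _ setT) => //.
  exact: (smooth_amplitude openT (smooth_open_id openT)).
have dflat w i : is_derive (0 : R) 1 (flat w i \o height) (0 * 'D_1 height 0).
  apply: is_derive1_comp => //; rewrite h0; exact: is_derive_flat0.
have dB := dflat 0 (0%N, 0).
have dS := is_deriveZ (sin th) (dflat 1 (0%N, 0)).
have dC := is_deriveZ (cos th) (dflat 1 (0%N, - (pi / 2))).
have dall := is_deriveB (is_deriveD (is_derive_cst (1 : R) (0 : R) (1 : R)) dB)
  (is_deriveM da (is_deriveB dS dC)).
apply: is_derive_eq dall _.
rewrite !mul0r !scaler0 !subrr scaler0 !add0r.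
by rewrite !fctE /= h0 !flat0 !scaler0 subrr scale0r oppr0.
Qed.

Lemma is_derive_warping_crit_th th : is_derive th 1 (warping 0) 0.
Proof.
have -> : warping 0 = cst 1.
  by apply/funext => t; rewrite warping_le0E// /height sin0 !mul0r.
exact: is_derive_cst.
Qed.

Section OnSpiral.
Variables (x th : R).
Hypotheses (s0 : 0 < sin x) (c0 : 0 < cos x) (sh : sin x ^+ 2 < 2^-1).
Hypothesis th_spiral : th = cos x / sin x.

Let cot_gt0 y : 0 < sin y -> 0 < cos y -> 0 < sin y / cos y.
Proof. by move=> ? ?; rewrite divr_gt0. Qed.

(** On the spiral the sine vanishes and the derivative of its argument is the
only trace of the oscillation: [d/dx] gives [e^(-th) (1 - c) / sin^2 x]. *)
Lemma is_derive_warping_spiral_x :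
  is_derive x 1 (warping^~ th) (sin x ^+ 2 * expR (- th)).
Proof.
pose cot y : R := cos y * (sin y)^-1.
pose local y : R := 1 + expR (- cot y) * (1 - amplitude y * sin (th - cot y)).
have near_local : \forall y \near x, local y = warping y th.
  have csin : sin y @[y --> x] --> sin x := @continuous_sin R x.
  have ccos : cos y @[y --> x] --> cos x := @continuous_cos R x.
  have ns : \forall y \near x, 0 < sin y by exact: cvgr_gt csin _ s0.
  have nc : \forall y \near x, 0 < cos y by exact: cvgr_gt ccos _ c0.
  have cs2 : sin y ^+ 2 @[y --> x] --> sin x ^+ 2.
    by apply: (cvgM csin csin).
  have ns2 : \forall y \near x, sin y ^+ 2 < 2^-1 by exact: cvgr_lt cs2 _ sh.
  near=> y.
  have sy : 0 < sin y by near: y.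
  have cy : 0 < cos y by near: y.
  have s2y : sin y ^+ 2 <= 2^-1 by apply: ltW; near: y.
  by rewrite warping_gt0E height_tan// ?cot_gt0// invf_div.
apply: near_eq_is_derive near_local _.
have s0' : sin x != 0 by rewrite gt_eqF.
have dsV := @is_deriveV R (@sin R) x _ 1 s0' (is_derive_sin x).
have dcot : is_derive x 1 cot (- sin x ^- 2).
  apply: is_derive_eq (is_deriveM (is_derive_cos x) dsV) _.
  rewrite /GRing.scale /= mulrCA !mulNr -expr2 cos2sin2 mulrN -exprVn.
  by field.
have cotx : cot x = th by rewrite th_spiral.
have dE := is_derive1_comp (is_derive_expR _) (is_deriveN dcot).
have dA := is_deriveB (is_derive_cst (1 : R) x (1 : R))
  (is_deriveX 4 (is_derive_sin x)).
have dth := is_deriveB (is_derive_cst th x (1 : R)) dcot.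
have dS := is_derive1_comp (is_derive_sin _) dth.
have dall := is_deriveD (is_derive_cst (1 : R) x (1 : R))
  (is_deriveM dE
    (is_deriveB (is_derive_cst (1 : R) x (1 : R)) (is_deriveM dA dS))).
apply: is_derive_eq dall _.
rewrite /GRing.scale /= !fctE /= /cst cotx subrr sin0 cos0.
by field.
Unshelve. all: by end_near. Qed.

Lemma is_derive_warping_spiral_th :
  is_derive th 1 (warping x) (- (amplitude x * expR (- th))).
Proof.
have s2 := ltW sh.
have -> : warping x =
    fun t => 1 + expR (- th) * (1 - amplitude x * sin (t - th)).
  apply/funext => t.
  by rewrite warping_gt0E height_tan// ?cot_gt0// invf_div th_spiral.
have dth := is_deriveB (is_derive_id th (1 : R)) (is_derive_cst th th (1 : R)).
have dS := is_derive1_comp (is_derive_sin _) dth.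
have dall := is_deriveD (is_derive_cst (1 : R) th (1 : R))
  (is_deriveZ (expR (- th)) (is_deriveB (is_derive_cst (1 : R) th (1 : R))
    (is_deriveZ (amplitude x) dS))).
apply: is_derive_eq dall _.
by rewrite /GRing.scale /= !fctE /= /cst subrr cos0; ring.
Qed.

Lemma fibre_metric_spiral : fibre_metric x = amplitude x.
Proof. by rewrite /fibre_metric bump_le0 ?addr0// subr_le0 ltW. Qed.

End OnSpiral.
End Potential.

(** * Tension of planes in a diagonal metric *)

Section Tension.
Context {R : realType} {n : nat}.
Local Notation E := 'rV[R]_n.

Lemma partial_near_cst m {W : normedModType R} (f : 'rV[R]_m -> W) (k : W)
    (x : 'rV[R]_m) i :
  (\forall y \near x, f y = k) -> partial i f x = 0.
Proof.
move=> fk; rewrite /partial (@near_eq_derive _ _ _ f (cst k))//.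
exact: derive_cst.
Qed.

Lemma christoffel_near_cst m (g : 'rV[R]_m -> 'M[R]_m) (A : 'M[R]_m)
    (x : 'rV[R]_m) :
  (\forall y \near x, g y = A) ->
  forall k i j, christoffel g k i j x = 0.
Proof.
move=> gA k i j; rewrite /christoffel big1 ?mulr0// => l _.
have p0 a b c : partial a (fun y => g y b c) x = 0.
  by apply: (@partial_near_cst _ _ _ (A b c)); apply: filterS gA => y ->.
by rewrite !p0 subr0 addr0 mulr0.
Qed.

Lemma invmx_diag (d : E) : (forall j, d 0 j != 0) ->
  invmx (diag_mx d) = diag_mx (\row_j (d 0 j)^-1).
Proof.
move=> d0; have dd : diag_mx d *m diag_mx (\row_j (d 0 j)^-1) = 1%:M.
  rewrite mulmx_diag; apply/matrixP => i j.
  by rewrite !mxE divff.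
have [du _] := mulmx1_unit dd.
by rewrite -[LHS]mulmx1 -dd mulKmx.
Qed.

Lemma christoffel_diag (d : E -> E) (k i : 'I_n) (x : E) :
  (forall j, d x 0 j != 0) ->
  (forall j, partial i (fun y => d y 0 j) x = 0) ->
  christoffel (fun y => diag_mx (d y)) k i i x =
  - 2^-1 * (d x 0 k)^-1 * partial k (fun y => d y 0 i) x.
Proof.
move=> d0 inert.
have offdiag j : partial i (fun y => diag_mx (d y) i j) x = 0.
  rewrite (_ : (fun y => diag_mx (d y) i j) = fun y => d y 0 i *+ (i == j)).
    by case: (i == j); [exact: inert|exact: derive_cst].
  by apply/funext => y; rewrite mxE.
rewrite /christoffel (bigD1 k)//= big1 ?addr0; last first.
  by move=> l lk; rewrite invmx_diag// mxE eq_sym (negPf lk) mulr0n mul0r.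
rewrite !offdiag invmx_diag// !mxE eqxx mulr1n addr0 sub0r.
under eq_fun do rewrite mxE eqxx mulr1n.
by rewrite mulrN mulrN mulNr mulNr mulrA.
Qed.

Hypothesis n_ge2 : (2 <= n)%N.
Local Notation flatten_ord := (widen_ord n_ge2).

Lemma pid_mx_widen (i : 'I_2) (a : 'I_n) :
  (pid_mx 2 : 'M[R]_(2, n)) i a = (a == flatten_ord i)%:R.
Proof. by rewrite mxE ltn_ord andbT eq_sym. Qed.

(** The second fundamental form of the plane comes from the Christoffel symbols
[Gamma^k_ii = - (d_k)^-1 (partial_k w) / 2] alone, and the trace over the two
directions of the plane cancels the factor 2: the tension is minus the gradient
of [w]. *)
Lemma tension_slice (d : E -> E) (w : E -> R) (g : 'rV[R]_2 -> 'M[R]_2)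
    (U : 'rV[R]_2 -> E) (q : E) (x : 'rV[R]_2) :
  (\forall y \near x, g y = 1%:M) ->
  (\forall y \near x, U y = y *m pid_mx 2 + q) ->
  (forall j, d (U x) 0 j != 0) ->
  (forall p i, d p 0 (flatten_ord i) = w p) ->
  (forall i j, partial (flatten_ord i) (fun y => d y 0 j) (U x) = 0) ->
  tension g (fun p => diag_mx (d p)) U x =
  \row_k - ((d (U x) 0 k)^-1 * partial k w (U x)).
Proof.
move=> g1 Uq d0 dw inert; apply/rowP => k; rewrite !mxE.
have dU i : partial i U x = row i (pid_mx 2).
  exact: nbhs_singleton (near_affine_partial i Uq).
have dUa i a : partial i U x 0 a = (a == flatten_ord i)%:R.
  by rewrite dU mxE pid_mx_widen.
have ddU i j : partial i (partial j U) x = 0 :> 'rV[R]_n.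
  exact: partial_near_cst (near_affine_partial j Uq).
have G0 := christoffel_near_cst g1.
have term i : \sum_a \sum_b christoffel (fun p => diag_mx (d p)) k a b (U x)
    * partial i U x 0 a * partial i U x 0 b =
    - 2^-1 * ((d (U x) 0 k)^-1 * partial k w (U x)).
  rewrite (bigD1 (flatten_ord i))//= [X in _ + X]big1 ?addr0; last first.
    move=> a ai; apply: big1 => b _.
    by rewrite dUa (negPf ai) mulr0 mul0r.
  rewrite (bigD1 (flatten_ord i))//= big1 ?addr0; last first.
    by move=> b bi; rewrite (dUa _ b) (negPf bi) mulr0.
  rewrite dUa eqxx !mulr1 christoffel_diag// mulrA.
  congr (_ * _); congr (partial k _ _); apply/funext => y; exact: dw.
have inner i : \sum_j invmx (g x) i j *
    (partial i (partial j U) x 0 k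
     - \sum_l christoffel g l i j x * partial l U x 0 k
     + \sum_a \sum_b christoffel (fun p => diag_mx (d p)) k a b (U x)
                     * partial i U x 0 a * partial j U x 0 b) =
    - 2^-1 * ((d (U x) 0 k)^-1 * partial k w (U x)).
  rewrite (nbhs_singleton g1) invmx1 (bigD1 i)//= [X in _ + X]big1 ?addr0;
    last first.
    by move=> j ji; rewrite mxE eq_sym (negPf ji) mul0r.
  rewrite mxE eqxx mul1r ddU [(0 : 'rV[R]_n) 0 k]mxE term.
  rewrite [X in _ - X]big1 ?subr0 ?add0r//.
  by move=> l _; rewrite G0 mul0r.
rewrite (eq_bigr _ (fun i _ => inner i)) sumr_const card_ord -[LHS]mulr_natl.
by rewrite mulrA mulrN divff ?mulN1r ?pnatr_eq0.
Qed.

End Tension.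

(** * Maps into quotient tori *)

Section LinearMaps.
Context {R : realType}.

Lemma rV_neq0 n (v : 'rV[R]_n) : v != 0 -> exists j, v 0 j != 0.
Proof.
move=> v0; apply/existsP; apply: contraNT v0.
rewrite negb_exists => /forallP v0; apply/eqP/rowP => j.
by rewrite mxE; apply/eqP; have := v0 j; rewrite negbK.
Qed.

Lemma is_derive_coord n (v p : 'rV[R]_n) j :
  is_derive p v (fun q => q 0 j) (v 0 j).
Proof.
have did : derivable (@id 'rV[R]_n) p v by exact: derivable_id.
apply: DeriveDef; first by have /derivable_mxP := did; exact.
have := derive_mx did.
rewrite derive_id => /(congr1 (fun M : 'rV[R]_n => M 0 j)).
by rewrite mxE.
Qed.

Lemma smooth_coord n (O : set 'rV[R]_n) j : open O ->
  smooth_open O (fun p : 'rV[R]_n => p 0 j).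
Proof.
move=> oO; apply: smooth_open_primitive => // [p _|v].
  exact: coord_continuous.
exists (cst (v 0 j)); first exact: smooth_open_cst.
by move=> p _; exact: is_derive_coord.
Qed.

Lemma smooth_open_sum {V : normedModType R} (O : set V) (I : Type) (s : seq I)
    (f : I -> V -> R) : open O -> (forall i, smooth_open O (f i)) ->
  smooth_open O (fun x => \sum_(i <- s) f i x).
Proof.
move=> oO sf; elim: s => [|i s IH].
  have := smooth_open_cst (0 : R) oO.
  by congr smooth_open; apply/funext => x; rewrite big_nil.
have := smooth_openD oO (sf i) IH.
by congr smooth_open; apply/funext => x; rewrite big_cons.
Qed.

Lemma mulmxr_continuous m n (A : 'M[R]_(m, n)) :
  continuous (fun x : 'rV[R]_m => x *m A).
Proof.
move=> x; apply: (@smooth_open_continuous _ _ _ setT) => //.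
apply: smooth_open_mx; first exact: openT.
move=> i j; have := @smooth_open_sum _ setT _ (index_enum 'I_m)
  (fun k (x : 'rV[R]_m) => x 0 k * A k j) openT.
rewrite (_ : (fun x : 'rV[R]_m => (x *m A) i j) =
    fun x => \sum_k x 0 k * A k j); last first.
  by apply/funext => y; rewrite mxE ord1.
apply => k; apply: (smooth_openM openT).
  by apply: smooth_coord; exact: openT.
by apply: smooth_open_cst; exact: openT.
Qed.

Lemma is_derive_mulmxr {V : normedModType R} m n (f : V -> 'rV[R]_m)
    (A : 'M[R]_(m, n)) (k : 'rV[R]_n) (x v : V) d :
  is_derive x v f d -> is_derive x v (fun y => f y *m A + k) (d *m A).
Proof.
move=> [df <-].
have quot : (fun h : R => h^-1 *: (((fun y => f y *m A + k) \o shift x) (h *: v)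
    - (f x *m A + k))) =
  (fun M => M *m A) \o (fun h => h^-1 *: ((f \o shift x) (h *: v) - f x)).
  by apply/funext => h /=; rewrite opprD addrACA subrr addr0 -mulmxBl scalemxAl.
have cvgl : h^-1 *: (((fun y => f y *m A + k) \o shift x) (h *: v)
    - (f x *m A + k)) @[h --> 0^'] --> 'D_v f x *m A.
  have c1 : h^-1 *: ((f \o shift x) (h *: v) - f x) @[h --> 0^'] --> 'D_v f x.
    exact: df.
  by rewrite quot; exact: (cvg_comp _ _ c1 (@mulmxr_continuous _ _ A _)).
by apply: DeriveDef; [apply/cvg_ex; exists ('D_v f x *m A)|exact: cvg_lim].
Qed.

End LinearMaps.

Section MapsIntoTorus.
Context {R : realType} {n : nat} (L : periodLattice R n).
Variable G : 'rV[R]_n -> 'M[R]_n.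
Hypothesis Gsmooth : smooth_open setT G.
Hypothesis Gposdef : forall x, posdef (G x).
Hypothesis Gperiodic : forall x v, periods L v -> G (x + v) = G x.
Local Notation N := (riemannian_torus Gsmooth Gposdef Gperiodic).
Local Notation prN := (qproj L : 'rV[R]_n -> N).

Lemma chart_proj_near (c : chart_index N) (p : 'rV[R]_n) : dom c (prN p) ->
  exists2 v, periods L v & \forall y \near p,
    dom c (prN y) /\ chart c (prN y) = y + v.
Proof.
move=> /tchart_proj_near[v Lv cp]; exists v => //.
apply: filterS cp => y [By cE]; split; last exact: cE.
by exists (y + v) => //; exact: qprojD.
Qed.

Lemma smooth_into_proj {V : normedModType R} (O A : set V) (f : V -> 'rV[R]_n) :
  open O -> A `<=` O -> smooth_open O f -> smooth_into A (prN \o f).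
Proof.
move=> oO AO sf x c Ax cx.
have [v Lv near_v] := @chart_proj_near c (f x) cx.
have Ox := AO _ Ax.
have cf : f @ x --> f x := smooth_open_continuous sf Ox.
pose P : set V := [set y | dom c (prN (f y)) /\ chart c (prN (f y)) = f y + v].
have Px : nbhs x P by exact: cf _ near_v.
exists (O `&` P°), (fun y => f y + v); split.
- by apply: openI => //; exact: open_interior.
- by split.
- by apply: smooth_open_addcst; apply: smooth_openS sf => y [].
- by move=> y [_ /interior_subset].
Qed.

(** Translates of one map [f] only differ by constants, also in charts: all
derivatives agree, and convergence of the translation vectors is enough for
smooth convergence. *)
Lemma smooth_cvg_translates (f : 'rV[R]_2 -> 'rV[R]_n) {I : Type}
    (F : set_system I) {FF : Filter F} (q : I -> 'rV[R]_n) (q_oo : 'rV[R]_n) :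
  continuous f -> q @ F --> q_oo ->
  smooth_cvg_map F (fun i x => prN (f x + q i)) (fun x => prN (f x + q_oo)).
Proof.
move=> cf cq x c cx; have [v Lv near_v] := chart_proj_near cx.
have /nbhs_ballP[e /= e0 eP] := near_v.
have e20 : 0 < e / 2 by rewrite divr_gt0.
have good y k : `|f x - f y| < e / 2 -> `|q_oo - k| < e / 2 ->
    dom c (prN (f y + k)) /\ chart c (prN (f y + k)) = f y + (k + v).
  move=> fy qk; rewrite addrA; apply: eP; rewrite -ball_normE /=.
  rewrite opprD addrACA (le_lt_trans (ler_normD _ _))// [ltRHS]splitr.
  exact: ltrD.
pose V := [set y | `|f x - f y| < e / 2].
have Vx : nbhs x V by have /cvgrPdist_lt := cf x; exact.
have near_q d : 0 < d -> \forall i \near F, `|q_oo - q i| < d.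
  by move: cq => /cvgrPdist_lt; exact.
have q_oo0 : `|q_oo - q_oo| < e / 2 by rewrite subrr normr0.
exists V°; split.
- exact: nbhs_interior.
- by move=> y /interior_subset Vy; have [] := good y q_oo Vy q_oo0.
- apply: filterS (near_q _ e20) => i qi y /interior_subset Vy.
  by have [] := good y _ Vy qi.
- move=> vs d d0; apply: filterS2 (near_q _ e20) (near_q _ d0) => i qi di y Vy.
  have chartE k : `|q_oo - k| < e / 2 -> iter_derive vs (chart c \o
      (fun x => prN (f x + k))) y
      = iter_derive vs f y + (if vs is [::] then k + v else 0).
    move=> qk; rewrite -iter_derive_addcst.
    have loc : \forall z \near y, (chart c \o (fun x => prN (f x + k))) z =
        f z + (k + v).
      by apply: filterS Vy => z Vz; have [_] := good z k Vz qk.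
    exact: (nbhs_singleton (near_eq_iter_derive vs loc)).
  rewrite (chartE _ qi) (chartE _ q_oo0) opprD addrACA subrr add0r.
  case: (vs) => [|_ _]; last by rewrite subrr normr0.
  by rewrite opprD addrACA subrr addr0 distrC.
Qed.

End MapsIntoTorus.

Lemma smooth_cvg_map_pointwise {R : realType} {n : nat}
    {N : closedRiemannian R n} {I : Type} (F : set_system I) {FF : Filter F}
    (u : I -> 'rV[R]_2 -> N) (u_oo : 'rV[R]_2 -> N) x :
  smooth_cvg_map F u u_oo -> u i x @[i --> F] --> u_oo x.
Proof.
move=> ucvg; have [c cx] := dom_cover (u_oo x).
have [V [Vx _ udom uchart]] := ucvg x c cx.
have Vx' := nbhs_singleton Vx.
have chart_cvg : chart c (u i x) @[i --> F] --> chart c (u_oo x).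
  apply/cvgrPdist_lt => e e0; apply: filterS (uchart [::] e e0) => i /(_ x Vx').
  by rewrite distrC.
have cim : (chart c @` dom c) (chart c (u_oo x)) by exists (u_oo x).
have pcvg : param c (chart c (u i x)) @[i --> F] --> param c (chart c (u_oo x)).
  exact: (cvg_comp _ _ chart_cvg (param_cont cim)).
rewrite (chartK cx) in pcvg; apply: cvg_trans pcvg; apply: near_eq_cvg.
by apply: filterS udom => i /(_ x Vx') /chartK.
Qed.

(** * The target manifold *)

Section Target.
Context {R : realType}.
Local Notation E := 'rV[R]_4.

Definition vec4 (a b c d : R) : E := \row_(j < 4) [:: a; b; c; d]`_j.

Definition oX : 'I_4 := @Ordinal 4 2 isT.
Definition oTh : 'I_4 := @Ordinal 4 3 isT.

Definition circle_length (j : 'I_4) : R := if (j < 2)%N then 1 else pi *+ 2.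

Lemma circle_length_ge1 j : 1 <= circle_length j.
Proof.
rewrite /circle_length; case: ifP => // _.
rewrite mulr2n; have := @pi_ge2 R; lra.
Qed.

Definition target_lattice : periodLattice R 4 := box_lattice circle_length_ge1.

Definition diagonal (p : E) : E := \row_j
  if (j < 2)%N then warping (p 0 oX) (p 0 oTh)
  else if j == oX then 1 else fibre_metric (p 0 oX).

Definition target_metric (p : E) : 'M[R]_4 := diag_mx (diagonal p).

Lemma diagonal_gt0 p j : 0 < diagonal p 0 j.
Proof.
rewrite mxE; case: ifP => _; first exact: lt_le_trans ltr01 (warping_ge1 _ _).
by case: ifP => // _; exact: fibre_metric_gt0.
Qed.

Lemma diagonal_invariant (p s : E) :
  (exists k : int, s 0 oX = k%:~R * (pi *+ 2)) ->
  (exists k : int, s 0 oTh = k%:~R * (pi *+ 2)) ->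
  diagonal (p + s) = diagonal p.
Proof.
move=> [k sk] [l sl]; apply/rowP => j; rewrite !mxE sk sl.
by rewrite warping_period fibre_metric_period.
Qed.

Lemma target_periods s : periods target_lattice s ->
  (exists k : int, s 0 oX = k%:~R * (pi *+ 2)) /\
  (exists k : int, s 0 oTh = k%:~R * (pi *+ 2)).
Proof. by move=> sL; split; [exact: (sL oX)|exact: (sL oTh)]. Qed.

Lemma target_metric_smooth : smooth_open setT target_metric.
Proof.
have sX := @smooth_coord R 4 setT oX openT.
have sT := @smooth_coord R 4 setT oTh openT.
have sW := smooth_warping openT sX sT.
have sB := smooth_fibre_metric openT sX.
apply: smooth_open_mx; first exact: openT.
move=> i j.
have -> : (fun p => target_metric p i j) = fun p =>
    (if (j < 2)%N then warping (p 0 oX) (p 0 oTh)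
     else if j == oX then 1 else fibre_metric (p 0 oX)) *+ (i == j).
  by apply/funext => p; rewrite !mxE; have [->|_] := eqVneq i j.
case: (i == j); last exact: (smooth_open_cst (0 : R) openT).
case: (j < 2)%N; first exact: sW.
by case: (j == oX); [exact: (smooth_open_cst (1 : R) openT)|exact: sB].
Qed.

Lemma target_metric_posdef p : posdef (target_metric p).
Proof.
split=> [|v v0]; first exact: tr_diag_mx.
have -> : (v *m target_metric p *m v^T) 0 0 =
    \sum_j diagonal p 0 j * v 0 j ^+ 2.
  rewrite mxE; apply: eq_bigr => j _; rewrite mul_mx_diag !mxE; ring.
have term_ge0 j : 0 <= diagonal p 0 j * v 0 j ^+ 2.
  by rewrite mulr_ge0 ?sqr_ge0// ltW// diagonal_gt0.
have [j vj] := rV_neq0 v0.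
rewrite (bigD1 j)//= ltr_pwDl ?sumr_ge0//.
by rewrite mulr_gt0 ?diagonal_gt0// lt_neqAle sqr_ge0 andbT eq_sym sqrf_eq0.
Qed.

Lemma target_metric_periodic (p v : E) :
  periods target_lattice v -> target_metric (p + v) = target_metric p.
Proof.
move=> /target_periods[vX vT]; rewrite /target_metric diagonal_invariant//.
Qed.

Definition target : closedRiemannian R 4 :=
  riemannian_torus target_metric_smooth target_metric_posdef
    target_metric_periodic.

Definition slice (q : E) (x : 'rV[R]_2) : target :=
  qproj target_lattice (x *m pid_mx 2 + q).

(** Minus the gradient of the warping function; see [tension_target]. *)
Definition force (q : E) : E :=
  \row_k - ((diagonal q 0 k)^-1 *
            partial k (fun p => warping (p 0 oX) (p 0 oTh)) q).

Lemma force_invariant (p s : E) :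
  (exists k : int, s 0 oX = k%:~R * (pi *+ 2)) ->
  (exists k : int, s 0 oTh = k%:~R * (pi *+ 2)) ->
  force (p + s) = force p.
Proof.
move=> sX sT; apply/rowP => k; rewrite !mxE.
have -> : partial k (fun p => warping (p 0 oX) (p 0 oTh)) (p + s) =
    partial k (fun p : E => warping (p 0 oX) (p 0 oTh)) p.
  apply: derive_invariant => y; have [a sa] := sX; have [b sb] := sT.
  by rewrite !mxE sa sb warping_period.
by have /rowP /(_ k) := diagonal_invariant p sX sT; rewrite !mxE => ->.
Qed.

Lemma pid_mx_oX (x : 'rV[R]_2) : (x *m pid_mx 2 : E) 0 oX = 0.
Proof.
by rewrite mxE big1// => -[[|[|//]] ?] _; rewrite [X in _ * X]mxE /= mulr0.
Qed.

Lemma pid_mx_oTh (x : 'rV[R]_2) : (x *m pid_mx 2 : E) 0 oTh = 0.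
Proof.
by rewrite mxE big1// => -[[|[|//]] ?] _; rewrite [X in _ * X]mxE /= mulr0.
Qed.

Lemma force_slice (q v : E) (x : 'rV[R]_2) : periods target_lattice v ->
  force (x *m pid_mx 2 + (q + v)) = force q.
Proof.
move=> /target_periods[[k vX] [l vT]].
rewrite [_ + (q + v)]addrC -addrA; apply: force_invariant.
  by exists k; rewrite mxE pid_mx_oX addr0.
by exists l; rewrite mxE pid_mx_oTh addr0.
Qed.

Lemma diagonal_slice (q v : E) (x : 'rV[R]_2) : periods target_lattice v ->
  diagonal (x *m pid_mx 2 + (q + v)) = diagonal q.
Proof.
move=> /target_periods[[k vX] [l vT]].
rewrite [_ + (q + v)]addrC -addrA; apply: diagonal_invariant.
  by exists k; rewrite mxE pid_mx_oX addr0.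
by exists l; rewrite mxE pid_mx_oTh addr0.
Qed.

Lemma slice_chart_near (q : E) (x : 'rV[R]_2) (c : chart_index target) :
  dom c (slice q x) ->
  exists2 v, periods target_lattice v & \forall y \near x,
    dom c (slice q y) /\ chart c (slice q y) = y *m pid_mx 2 + (q + v).
Proof.
move=> cx.
have [v Lv near_v] := @chart_proj_near _ _ _ _ target_metric_smooth
  target_metric_posdef target_metric_periodic c (x *m pid_mx 2 + q) cx.
exists v => //.
have ct : (y *m pid_mx 2 + q : E) @[y --> x] --> x *m pid_mx 2 + q.
  exact: (cvg_comp _ _ (@mulmxr_continuous R 2 4 (pid_mx 2) x)
    (@translation_continuous R 4 q _)).
have near_x : \forall y \near x, dom c (slice q y) /\
    chart c (slice q y) = y *m pid_mx 2 + q + v := ct _ near_v.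
by apply: filterS near_x => y; rewrite addrA.
Qed.

Lemma partial_coords (f : R -> R -> R) (k : 'I_4) (p : E) d :
  is_derive (0 : R) 1 (fun h => f (h * (k == oX)%:R + p 0 oX)
                           (h * (k == oTh)%:R + p 0 oTh)) d ->
  partial k (fun p => f (p 0 oX) (p 0 oTh)) p = d.
Proof.
move=> df; suff [_] : is_derive p (delta_mx 0 k)
  (fun p : E => f (p 0 oX) (p 0 oTh)) d by [].
apply/is_derive_line; move: df; congr is_derive.
apply/funext => h; rewrite !mxE !eqxx /=.
by rewrite ![oX == _]eq_sym ![oTh == _]eq_sym.
Qed.

Lemma partial_plane (f : R -> R -> R) (i : 'I_2) (p : E) :
  partial (widen_ord (isT : (2 <= 4)%N) i) (fun p => f (p 0 oX) (p 0 oTh)) p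
  = 0.
Proof.
apply: partial_coords; have -> : widen_ord (isT : (2 <= 4)%N) i == oX = false.
  by apply/negbTE; rewrite -val_eqE /= neq_ltn ltn_ord.
have -> : widen_ord (isT : (2 <= 4)%N) i == oTh = false.
  by apply/negbTE; rewrite -val_eqE /= neq_ltn ltnW// ltnS ltn_ord.
rewrite (_ : (fun h => _) = cst (f (p 0 oX) (p 0 oTh))).
  exact: is_derive_cst.
by apply/funext => h; rewrite !mulr0 !add0r.
Qed.

Lemma partial_X (f : R -> R -> R) (p : E) d :
  is_derive (p 0 oX) 1 (f^~ (p 0 oTh)) d ->
  partial oX (fun p => f (p 0 oX) (p 0 oTh)) p = d.
Proof.
move=> /is_derive_line df; apply: partial_coords; move: df.
by congr is_derive; apply/funext => h; rewrite eqxx /= mulr0 add0r.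
Qed.

Lemma partial_Th (f : R -> R -> R) (p : E) d :
  is_derive (p 0 oTh) 1 (f (p 0 oX)) d ->
  partial oTh (fun p => f (p 0 oX) (p 0 oTh)) p = d.
Proof.
move=> /is_derive_line df; apply: partial_coords; move: df.
by congr is_derive; apply/funext => h; rewrite eqxx /= mulr0 add0r.
Qed.

Lemma forceE (q : E) (a b : R) :
  is_derive (q 0 oX) 1 (warping^~ (q 0 oTh)) a ->
  is_derive (q 0 oTh) 1 (warping (q 0 oX)) b ->
  force q = vec4 0 0 (- a) (- ((fibre_metric (q 0 oX))^-1 * b)).
Proof.
move=> da db; apply/rowP => k; rewrite !mxE.
case: k => [[|[|[|[|//]]]] lt_k4] /=.
- have := partial_plane warping ord0 q.
  rewrite (_ : widen_ord _ _ = Ordinal lt_k4); last exact: val_inj.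
  by move=> ->; rewrite mulr0 oppr0.
- have := partial_plane warping (lift ord0 ord0) q.
  rewrite (_ : widen_ord _ _ = Ordinal lt_k4); last exact: val_inj.
  by move=> ->; rewrite mulr0 oppr0.
- rewrite (_ : Ordinal lt_k4 = oX); last exact: val_inj.
  by rewrite (partial_X da) ?eqxx invr1 mul1r.
- rewrite (_ : Ordinal lt_k4 = oTh); last exact: val_inj.
  by rewrite (partial_Th db).
Qed.

Lemma tension_target (g : 'rV[R]_2 -> 'M[R]_2) (c : chart_index target) q x :
  (\forall y \near x, g y = 1%:M) -> dom c (slice q x) ->
  tension g (cmetric c) (chart c \o slice q) x = force q.
Proof.
move=> g1 cx; have [v Lv near_v] := slice_chart_near cx.
have Uq : \forall y \near x, (chart c \o slice q) y = y *m pid_mx 2 + (q + v).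
  by apply: filterS near_v => y [].
rewrite (@tension_slice R 4 isT diagonal (fun p => warping (p 0 oX) (p 0 oTh))
  g _ (q + v))//.
- by rewrite -(force_slice q x Lv) -(nbhs_singleton Uq).
- by move=> j; rewrite gt_eqF// diagonal_gt0.
- by move=> p i; rewrite mxE /= ltn_ord.
- move=> i j; pose f a b : R := if (j < 2)%N then warping a b
      else if j == oX then 1 else fibre_metric a.
  rewrite -(partial_plane f i (( chart c \o slice q) x)).
  by congr partial; apply/funext => y; rewrite mxE.
Qed.

End Target.

(** * Geometry of the horizontal tori *)

Section Slices.
Context {R : realType}.
Local Notation E := 'rV[R]_4.

Lemma pid_pullback_target (p : E) :
  (pid_mx 2 : 'M[R]_(2, 4)) *m target_metric p *m (pid_mx 2)^T =
  (warping (p 0 oX) (p 0 oTh))%:M.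
Proof.
apply/matrixP => i j; rewrite mxE.
rewrite (bigD1 (widen_ord (isT : (2 <= 4)%N) i))//= big1 ?addr0; last first.
  by move=> a ai; rewrite mul_mx_diag mxE pid_mx_widen (negPf ai) !mul0r.
rewrite mul_mx_diag !mxE !eqxx /= !ltn_ord /= mul1r.
by rewrite andbT eq_sym val_eqE mulr_natr.
Qed.

Lemma dmx_id n (x : 'rV[R]_n) : dmx id x = 1%:M.
Proof.
apply/matrixP => i j; rewrite !mxE /partial derive_id mxE eqxx /=.
by rewrite eq_sym.
Qed.

Lemma dmx_affine_comp (xi : 'rV[R]_2 -> 'rV[R]_2) (f : 'rV[R]_2 -> E)
    (A : 'M[R]_(2, 4)) (k : E) (z : 'rV[R]_2) :
  (forall v, derivable xi z v) ->
  (\forall y \near z, f y = xi y *m A + k) -> dmx f z = dmx xi z *m A.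
Proof.
move=> dxi fA; apply/row_matrixP => i.
rewrite row_mul; have -> : row i (dmx f z) = partial i f z.
  by apply/rowP => j; rewrite !mxE.
have -> : row i (dmx xi z) = partial i xi z.
  by apply/rowP => j; rewrite !mxE.
rewrite /partial (near_eq_derive _ fA).
by have [_ ->] := is_derive_mulmxr A k (derivableP (dxi (delta_mx 0 i))).
Qed.

Lemma warping_slice (q v : E) (x : 'rV[R]_2) : periods target_lattice v ->
  warping ((x *m pid_mx 2 + (q + v)) 0 oX) ((x *m pid_mx 2 + (q + v)) 0 oTh)
  = warping (q 0 oX) (q 0 oTh).
Proof.
move=> Lv; have /rowP /(_ ord0) := diagonal_slice q x Lv.
by rewrite [LHS]mxE [RHS]mxE.
Qed.

(** The slices are homothetic immersions: the metric is [w] times the Euclidean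
one on the first two coordinates.  This makes their Hopf differentials vanish
and reduces their mean curvature to [force]. *)
Lemma pullback_slice (c : chart_index target) (q : E)
    (xi : 'rV[R]_2 -> 'rV[R]_2) (z : 'rV[R]_2) :
  {for z, continuous xi} -> (forall v, derivable xi z v) ->
  dom c (slice q (xi z)) ->
  pullback_metric c (slice q \o xi) z =
  warping (q 0 oX) (q 0 oTh) *: pullback xi (fun=> 1%:M) z.
Proof.
move=> cxi dxi cz; have [v Lv near_v] := slice_chart_near cz.
have near_z : \forall y \near z, (chart c \o (slice q \o xi)) y =
    xi y *m pid_mx 2 + (q + v).
  have : \forall y \near z, dom c (slice q (xi y)) /\
    chart c (slice q (xi y)) = xi y *m pid_mx 2 + (q + v) := cxi _ near_v.
  by apply: filterS => y [].
rewrite /pullback_metric /pullback (dmx_affine_comp dxi near_z).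
rewrite (nbhs_singleton near_z) trmx_mul mulmxA -(mulmxA _ _ (_^T)).
rewrite -!mulmxA (mulmxA (pid_mx 2)) (mulmxA (pid_mx 2 *m _)).
rewrite pid_pullback_target warping_slice//.
by rewrite !mul_scalar_mx -!scalemxAr scale1r.
Qed.

Lemma slice_periodic (q : E) : Defs.periodic (slice q).
Proof.
move=> x v Lv; apply/qprojP; rewrite mulmxDl.
rewrite (_ : _ - _ = v *m pid_mx 2); last first.
  by rewrite opprD addrACA subrr addr0 addrAC subrr add0r.
move=> j; have [j2|j2] := ltnP j 2.
  have /intrP[k vk] := Lv (Ordinal j2); exists k.
  rewrite /circle_length j2 mulr1 -vk mxE (bigD1 (Ordinal j2))//= big1 ?addr0.
    by rewrite mxE /= eqxx j2 mulr1.
  move=> i ij; rewrite [X in _ * X]mxE -val_eqE /= in ij *.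
  by rewrite (negPf ij) mulr0.
exists 0; rewrite mul0r mxE big1// => i _.
by rewrite [X in _ * X]mxE ltn_eqF ?mulr0// (leq_trans (ltn_ord i)).
Qed.

Lemma smooth_slice_lift (q : E) :
  smooth_open setT (fun x : 'rV[R]_2 => x *m pid_mx 2 + q).
Proof.
apply: smooth_open_addcst; apply: (smooth_open_linear (f := mulmxr (pid_mx 2))).
  exact: openT.
exact: mulmxr_continuous.
Qed.

Lemma slice_smooth (q : E) : smooth_into [set: 'rV[R]_2] (slice q).
Proof.
apply: (@smooth_into_proj R 4 target_lattice _ target_metric_smooth
  target_metric_posdef target_metric_periodic _ setT) => //; first exact: openT.
exact: smooth_slice_lift.
Qed.

Lemma slice_minimal_immersion (q : E) :
  q 0 oX = 0 -> minimal_immersion (slice q).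
Proof.
move=> qX; split; [exact: slice_periodic|exact: slice_smooth|move=> x c cx].
have [v Lv near_v] := slice_chart_near cx.
split.
  have aff : \forall y \near x,
      (chart c \o slice q) y = y *m pid_mx 2 + (q + v).
    by apply: filterS near_v => y [].
  rewrite (nbhs_singleton (near_affine_dmx aff)).
  by rewrite /row_free rank_pid_mx.
rewrite tension_target//.
  have dX := is_derive_warping_crit_x (q 0 oTh).
  have dT := is_derive_warping_crit_th (q 0 oTh).
  rewrite -qX in dX dT; rewrite (forceE dX dT); apply/rowP => k.
  by rewrite !mxE qX mulr0 oppr0; case: k => [[|[|[|[|//]]]] ?].
apply: filterS near_v => y [cy _].
have did (w : 'rV[R]_2) : derivable (@id 'rV[R]_2) y w by exact: derivable_id.
rewrite -[slice q]/(slice q \o id) (pullback_slice _ did cy)//.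
rewrite qX warping_le0E ?scale1r; last by rewrite /height sin0 !mul0r.
by rewrite /pullback dmx_id trmx1 !mulmx1.
Qed.

Lemma hopf_slice (q : E) : hopf_differential (slice q) (fun=> 1%:M) (fun=> 0).
Proof.
split=> // O xi z c [oO sxi _ _ conf] Oz cz /=.
have [lambda _ xi_conf] := conf z Oz.
rewrite (pullback_slice (smooth_open_continuous sxi Oz)
  (fun v => smooth_open_derivable sxi Oz) cz).
rewrite xi_conf !mxE /= !mulr1n !mulr0n mulr0 subrr mulr0 oppr0.
rewrite [Complex 0 0](_ : _ = 0)// scale0r.
by rewrite /cpullback mulmx0 mul0mx.
Qed.

End Slices.

(** * The spiral gradient line *)

Section Spiral.
Context {R : realType}.
Local Notation E := 'rV[R]_4.

(** The delay keeps the spiral in the region [sin^2 x < 1/2], where the bumps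
vanish, from time 0 on. *)
Definition delay : R := expR (pi *+ 2).

Definition angle (t : R) : R := ln (t + delay).

(** On the curve [th = 1 / tan x], the gradient flow reduces to
[th' = e^(-th)], whose solution is [angle]. *)
Definition spiral (t : R) : E := vec4 0 0 (atan (angle t)^-1) (angle t).

Lemma delay_gt1 : 1 < delay.
Proof. by rewrite /delay expR_gt1 mulr2n; have := @pi_gt0 R; lra. Qed.

Lemma angle_gt0 t : 1 < t + delay -> 0 < angle t.
Proof. by move=> ?; exact: ln_gt0. Qed.

Lemma time_ge0 t : 0 <= t -> 1 < t + delay.
Proof. by move=> t0; have := delay_gt1; lra. Qed.

Lemma angle_gt1 t : 0 <= t -> 1 < angle t.
Proof.
move=> t0; apply: (@lt_le_trans _ _ (pi *+ 2)).
  by rewrite mulr2n; have := @pi_ge2 R; lra.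
rewrite -[leLHS]expRK ler_ln ?posrE ?expR_gt0 ?ltr_wpDl ?expR_gt0//.
by rewrite /delay lerDr.
Qed.

Lemma open_times : open [set t : R | 1 < t + delay].
Proof.
rewrite (_ : [set t : R | 1 < t + delay] = [set t | 1 - delay < t]).
  exact: open_gt.
by apply/seteqP; split => t /=; rewrite ltrBlDr.
Qed.

Section SmoothSpiral.
Context {V : normedModType R} (O : set V) (oO : open O) (f : V -> R).
Hypotheses (sf : smooth_open O f) (fO : forall x, O x -> 1 < f x + delay).

Lemma smooth_angle : smooth_open O (fun x => angle (f x)).
Proof.
apply: (smooth_open_comp oO smooth_ln
  (smooth_openD oO sf (smooth_open_cst delay oO))).
by move=> x /fO /=; exact: lt_trans.
Qed.

Lemma smooth_spiral : smooth_open O (fun x => spiral (f x)).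
Proof.
have sA := smooth_angle.
have sV : smooth_open O (fun x => (angle (f x))^-1).
  apply: (smooth_open_comp oO smooth_inv sA) => x /fO /angle_gt0 /=.
  by move=> /lt0r_neq0.
have sX := smooth_open_comp oO smooth_atan sV.
have s0 := smooth_open_cst (0 : R) oO.
apply: smooth_open_mx; first exact: oO.
move=> i j; have -> : (fun x => spiral (f x) i j) = fun x =>
    [:: 0; 0; atan (angle (f x))^-1; angle (f x)]`_j.
  by apply/funext => x; rewrite !mxE.
case: j => [[|[|[|[|k]]]] jk] /=.
- exact: s0.
- exact: s0.
- exact: sX.
- exact: sA.
- by exfalso; move: jk; rewrite !ltnS ltn0.
Qed.

End SmoothSpiral.

Lemma is_derive_angle (t : R) : 1 < t + delay ->
  is_derive t 1 angle (t + delay)^-1.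
Proof.
move=> t1; have t0 : 0 < t + delay by exact: lt_trans t1.
have dln : is_derive ((id + cst delay : R -> R) t) 1 (@ln R) (t + delay)^-1.
  exact: is_derive1_ln.
have dsh := is_deriveD (is_derive_id t (1 : R)) (is_derive_cst delay t (1 : R)).
have -> : angle = @ln R \o (id + cst delay) by apply/funext.
apply: is_derive_eq (is_derive1_comp dln dsh) _.
by rewrite addr0 mulr1.
Qed.

Lemma tan_spiral (t : R) (x := atan (angle t)^-1) : 0 <= t ->
  [/\ 0 < sin x, 0 < cos x, sin x ^+ 2 < 2^-1, angle t = cos x / sin x
    & sin x ^+ 2 = (1 + angle t ^+ 2)^-1].
Proof.
move=> t0; have a1 := angle_gt1 t0; have a0 : 0 < angle t by lra.
have c0 : 0 < cos x.
  by apply: cos_gt0_pihalf; rewrite /x atan_gtNpi2 atan_ltpi2.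
have tanx : sin x / cos x = (angle t)^-1 by rewrite -[RHS]atanK.
have sinx : sin x = cos x / angle t.
  by rewrite -tanx mulrCA divff ?mulr1// gt_eqF.
have s0 : 0 < sin x by rewrite sinx divr_gt0.
have s2 : sin x ^+ 2 = (1 + angle t ^+ 2)^-1.
  have a21 : 1 + angle t ^+ 2 != 0 by rewrite gt_eqF// ltr_wpDr ?sqr_ge0.
  apply: (mulIf a21); rewrite mulVf// mulrDr mulr1.
  have -> : sin x ^+ 2 * angle t ^+ 2 = cos x ^+ 2.
    by rewrite -exprMn sinx divfK// gt_eqF.
  by rewrite addrC cos2Dsin2.
split => //.
- have a2 : 0 < 1 + angle t ^+ 2 by rewrite ltr_wpDr ?sqr_ge0.
  rewrite s2 ltf_pV2 ?posrE ?ltr0n//.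
  have : 1 < angle t ^+ 2 by rewrite expr_gt1// ltW.
  lra.
- by rewrite -[LHS]invrK -tanx invf_div.
Qed.

Lemma force_spiral (t : R) : 0 <= t ->
  force (spiral t) = vec4 0 0 (- ((1 + angle t ^+ 2)^-1 * (t + delay)^-1))
                              (t + delay)^-1.
Proof.
move=> t0; have [s0 c0 s2 aE s2E] := tan_spiral t0.
have td0 : 0 < t + delay by apply: lt_trans (time_ge0 t0).
have spX : spiral t 0 oX = atan (angle t)^-1 by rewrite mxE.
have spT : spiral t 0 oTh = angle t by rewrite mxE.
have expa : expR (- angle t) = (t + delay)^-1 by rewrite expRN lnK.
have dX := is_derive_warping_spiral_x s0 c0 s2 aE.
have dT := is_derive_warping_spiral_th s0 c0 s2 aE.
have fib := fibre_metric_spiral s2.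
rewrite -spX -spT in dX dT; rewrite (forceE dX dT).
rewrite spX spT fib s2E expa; congr vec4.
have amp0 : amplitude (atan (angle t)^-1) != 0.
  by rewrite -fib gt_eqF// fibre_metric_gt0.
by rewrite mulrN opprK mulKf.
Qed.

Lemma is_derive_spiral (t : R) : 0 <= t ->
  is_derive t 1 spiral (force (spiral t)).
Proof.
move=> t0; have t1 := time_ge0 t0; have a0 := angle_gt0 t1.
have dA := is_derive_angle t1.
have dV := is_deriveV (lt0r_neq0 a0) dA.
have dX := is_derive1_comp (is_derive1_atan _) dV.
have sp : derivable spiral t 1.
  apply: (@smooth_open_derivable _ _ _ [set t : R | 1 < t + delay]) => //.
  apply: (@smooth_spiral R _ open_times id) => //.
  exact: smooth_open_id open_times.
apply: DeriveDef => //; rewrite (derive_mx sp) force_spiral//.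
apply/rowP => j; rewrite !mxE.
have -> : (fun s => spiral s 0 j) =
    fun s => [:: 0; 0; atan (angle s)^-1; angle s]`_j.
  by apply/funext => s; rewrite mxE.
case: j => [[|[|[|[|//]]]] ?] /=; [exact: derive_cst|exact: derive_cst| |].
- have [_ dE] := dX; apply: etrans dE _.
  have td0 : t + delay != 0 by rewrite gt_eqF// (lt_trans _ t1).
  have a2 : 1 + angle t ^+ 2 != 0 by rewrite gt_eqF// ltr_wpDr ?sqr_ge0.
  rewrite /GRing.scale /= mulNr mulrN; congr (- _); field.
  by rewrite td0 a2 gt_eqF.
- by have [_ ->] := dA.
Qed.

End Spiral.

(** * The square torus *)

Section SquareTorus.
Context {R : realType}.

Lemma torus_integral_cst (k : R) : torus_integral (fun=> k) = k.
Proof.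
rewrite /torus_integral Rintegral_cst; last first.
  by apply: measurableX; exact: measurable_itv.
rewrite [X in fine X](_ : _ = 1%E) ?mulr1//.
apply: etrans (product_measure1E _ _ _ _) _; [exact: measurable_itv..|].
rewrite /= lebesgue_measure_itv /= lte_fin ltr01 oppr0 adde0 mule1//.
Qed.

Lemma flat_unit_metric1 : flat_unit_metric (fun=> 1%:M : 'M[R]_2).
Proof.
have G0 k i j : christoffel (fun=> 1%:M : 'M[R]_2) k i j = cst 0.
  apply/funext => x; apply: (@christoffel_near_cst _ _ _ 1%:M).
  exact: filterE.
split => //.
- exact: smooth_open_cst openT.
- move=> x; split=> [|v v0]; first exact: trmx1.
  rewrite mulmx1 mxE; under eq_bigr do rewrite mxE -expr2.
  have [j vj] := rV_neq0 v0.
  rewrite (bigD1 j)//= ltr_pwDl ?sumr_ge0// => [|i _]; last exact: sqr_ge0.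
  by rewrite lt_neqAle sqr_ge0 andbT eq_sym sqrf_eq0.
- move=> l i j k x; rewrite /curvature !G0 big1 => [|p _]; last first.
    by rewrite !G0 !mul0r subrr.
  by rewrite /partial !derive_cst subrr addr0.
- by under eq_fun do rewrite det1 sqrtr1; exact: torus_integral_cst.
Qed.

Lemma teich_equiv1 : teich_equiv (fun=> 1%:M : 'M[R]_2) (teich_rep (0, 1)).
Proof.
have sid : smooth_open setT (@id 'rV[R]_2) by exact: smooth_open_id openT.
have lat0 : Defs.lattice (0 : 'rV[R]_2) by move=> j; rewrite mxE.
have tid : torus_map (@id 'rV[R]_2).
  by move=> x v Lv; rewrite addrAC subrr add0r.
have latxx (x : 'rV[R]_2) : Defs.lattice (x - x) by rewrite subrr.
exists id; split.
- by split => //; exists id.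
- exists snd; split => //; apply: continuous_subspaceT => x; exact: cvg_snd.
- apply/funext => x; rewrite /teich_rep /= sqrtr1 invr1 scale1r.
  have -> : col_mx (vec2 1 0) (vec2 0 1) = 1%:M :> 'M[R]_2.
    apply/matrixP => i j; rewrite !mxE.
    case: splitP => k; rewrite !ord1 !mxE => /eqP.
      by case: i j => [[|[|//]] ?] [[|[|//]] ?].
    by case: i j => [[|[|//]] ?] [[|[|//]] ?].
  rewrite /pullback dmx_id (_ : mulmx^~ 1%:M = id).
    by rewrite dmx_id trmx1 !mulmx1.
  by apply/funext => y; rewrite mulmx1.
Qed.

Lemma holomorphic_projection0 :
  holomorphic_projection (fun=> 1%:M : 'M[R]_2) (fun=> 0) (fun=> 0).
Proof.
split.
  split=> // O xi _; exists (cst 0) => z Oz; split.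
    by rewrite scale0r /cpullback mulmx0 mul0mx.
  exact: derivable_cst.
move=> k _; rewrite /L2_inner /=.
have z0 x : \tr (map_mx (real_complex R) (invmx 1%:M) *m (0 - 0)
    *m map_mx (real_complex R) (invmx 1%:M) *m
    (map_mx (fun z : R[i] => z^*) (k x))^T) = 0.
  by rewrite subrr mulmx0 !mul0mx mxtrace0.
under [X in Complex (torus_integral X)]eq_fun do rewrite z0 /= mul0r.
under [X in Complex _ (torus_integral X)]eq_fun do rewrite z0 /= mul0r.
by rewrite torus_integral_cst.
Qed.

End SquareTorus.

(** * The solution and its limits *)

Section Solution.
Context {R : realType}.
Local Notation E := 'rV[R]_4.

Definition solution (t : R) : 'rV[R]_2 -> target := slice (spiral t).

Lemma solution_smooth :
  smooth_into ([set t : R | 0 <= t] `*` [set: 'rV[R]_2])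
    (fun p => solution p.1 p.2).
Proof.
pose O : set (R * 'rV[R]_2) := fst @^-1` [set t : R | 1 < t + delay].
have oO : open O by apply: open_comp open_times => p _; exact: cvg_fst.
apply: (@smooth_into_proj R 4 target_lattice _ target_metric_smooth
  target_metric_posdef target_metric_periodic _ O _
  (fun p : R * 'rV[R]_2 => p.2 *m pid_mx 2 + spiral p.1)) => //.
  by move=> p [/= p0 _]; exact: time_ge0.
apply: smooth_openD => //.
  apply: (smooth_open_linear (f := mulmxr (pid_mx 2) \o snd)) => // p.
  by apply: continuous_comp; [exact: cvg_snd|exact: mulmxr_continuous].
apply: (smooth_spiral oO) => //.
by apply: smooth_open_linear => // p; exact: cvg_fst.
Qed.

Lemma solution_heat_flow (t : R) x (c : chart_index target) :
  0 <= t -> dom c (solution t x) ->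
  'D_1 (fun s => chart c (solution s x)) t =
  tension (fun=> 1%:M) (cmetric c) (chart c \o solution t) x.
Proof.
move=> t0 cx; rewrite tension_target//; last exact: filterE.
have [v Lv near_v] := @chart_proj_near _ _ _ _ target_metric_smooth
  target_metric_posdef target_metric_periodic c (x *m pid_mx 2 + spiral t) cx.
have [dsp dspE] := is_derive_spiral t0.
have csp : (x *m pid_mx 2 + spiral s : E) @[s --> t] -->
    x *m pid_mx 2 + spiral t.
  have csp : spiral s @[s --> t] --> spiral t.
    by apply: differentiable_continuous; exact/derivable1_diffP.
  by apply: cvgD => //; exact: cvg_cst.
have near_t : \forall s \near t, chart c (solution s x) =
    spiral s + (x *m pid_mx 2 + v).
  have : \forall s \near t, dom c (solution s x) /\ chart c (solution s x) =
      x *m pid_mx 2 + spiral s + v := csp _ near_v.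
  by apply: filterS => s [_ ->]; rewrite [x *m _ + _]addrC addrA.
rewrite (near_eq_derive _ near_t) -dspE.
exact: (congr1 (fun f => f t) (derive_addcst spiral _ 1)).
Qed.

Lemma solution_flow (eta : R) :
  teichmuller_flow eta solution (fun _ _ => 1%:M).
Proof.
split.
- by move=> t _; split; [exact: slice_periodic|exact: flat_unit_metric1].
- exact: solution_smooth.
- move=> x _; exists setT, (fun=> 1%:M); split => //; first exact: openT.
  by apply: smooth_open_cst; exact: openT.
- by move=> t x c /ltW; exact: solution_heat_flow.
- move=> t _; exists (fun=> 0), (fun=> 0); split.
  + exact: hopf_slice.
  + exact: holomorphic_projection0.
  + move=> x; rewrite derive_cst; apply/matrixP => i j.
    by rewrite !mxE mulr0.
Qed.

(** The times at which the angle of the spiral is [phi] modulo [2 pi]. *)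
Definition return_time (phi : R) (n : nat) : R :=
  expR (n.+1%:R * (pi *+ 2) + phi) - delay.

Definition limit_slice (phi : R) : 'rV[R]_2 -> target :=
  slice (vec4 0 0 0 phi).

Lemma pi2_gt1 : 1 < pi *+ 2 :> R.
Proof. by rewrite mulr2n; have := @pi_ge2 R; lra. Qed.

Lemma angle_return (phi : R) n :
  angle (return_time phi n) = n.+1%:R * (pi *+ 2) + phi.
Proof. by rewrite /angle subrK expRK. Qed.

Lemma return_angle_ge (phi : R) n :
  0 <= phi -> n%:R <= n.+1%:R * (pi *+ 2) + phi.
Proof.
move=> phi0; have n0 : 0 <= n.+1%:R :> R by rewrite ler0n.
have le : n.+1%:R <= n.+1%:R * (pi *+ 2) :> R.
  by rewrite ler_peMr// ltW// pi2_gt1.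
have : n%:R <= n.+1%:R :> R by rewrite ler_nat.
lra.
Qed.

Lemma return_time_cvg (phi : R) :
  0 <= phi -> return_time phi n @[n --> \oo] --> +oo.
Proof.
move=> phi0; apply/cvgryPge => A.
near=> n; rewrite lerBrDr.
apply: le_trans (le_trans (return_angle_ge n phi0) _).
  near: n; exact: nbhs_infty_ger.
by apply: le_trans (expR_ge1Dx _); rewrite lerDr.
Unshelve. all: by end_near. Qed.

Lemma solution_return (phi : R) n : solution (return_time phi n) =
  slice (vec4 0 0 (atan (n.+1%:R * (pi *+ 2) + phi)^-1) phi).
Proof.
apply/funext => x; apply/qprojP => j.
rewrite /spiral angle_return opprD addrACA subrr add0r.
case: j => [[|[|[|[|k]]]] jk].
- by exists 0; rewrite !mxE /= subrr mul0r.
- by exists 0; rewrite !mxE /= subrr mul0r.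
- by exists 0; rewrite !mxE /= subrr mul0r.
- by exists n.+1; rewrite !mxE /= addrK.
- by exfalso; move: jk; rewrite !ltnS ltn0.
Qed.

Lemma smooth_cvg_return (phi : R) : 0 <= phi ->
  smooth_cvg \oo (solution \o return_time phi) (fun _ _ => 1%:M)
    (limit_slice phi) (fun=> 1%:M : 'M[R]_2).
Proof.
move=> phi0; split.
- exact: slice_periodic.
- exact: slice_smooth.
- exact: flat_unit_metric1.
- rewrite (_ : solution \o return_time phi = fun n =>
      slice (vec4 0 0 (atan (n.+1%:R * (pi *+ 2) + phi)^-1) phi)); last first.
    by apply/funext => n; exact: solution_return.
  apply: (@smooth_cvg_translates R 4 target_lattice _ target_metric_smooth
    target_metric_posdef target_metric_periodic (fun x => x *m pid_mx 2)).
    exact: mulmxr_continuous.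
  have cX : atan (n.+1%:R * (pi *+ 2) + phi)^-1 @[n --> \oo] --> (0 : R).
    have cV : (n.+1%:R * (pi *+ 2) + phi)^-1 @[n --> \oo] --> (0 : R).
      apply/gtr0_cvgV0.
        near=> n; apply: lt_le_trans (return_angle_ge n phi0).
        by rewrite ltr0n; near: n; exact: nbhs_infty_gt.
      apply/cvgryPge => A; near=> n.
      apply: le_trans (return_angle_ge n phi0).
      near: n; exact: nbhs_infty_ger.
    rewrite -[X in _ --> X]atan0.
    by apply: (cvg_comp _ _ cV); exact: continuous_atan.
  apply/cvgrPdist_lt => e e0; move/cvgrPdist_lt : cX => /(_ e e0).
  apply: filterS => n; rewrite sub0r normrN => Xe.
  rewrite [ltLHS]/Num.Def.normr/= mx_normrE.
  apply: bigmax_lt => // -[i j] _ /=; rewrite !mxE.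
  case: j => [[|[|[|[|k]]]] jk] /=; rewrite ?subrr ?normr0 ?sub0r ?normrN//.
- by move=> vs e e0; apply: filterE => n x; rewrite subrr normr0.
Unshelve. all: by end_near. Qed.

Lemma limit_slices_disjoint (x y : 'rV[R]_2) :
  limit_slice 0 x <> limit_slice pi y.
Proof.
move=> /qprojP /(_ oTh) [k].
rewrite [LHS]mxE [X in X + _]mxE [X in _ + X]mxE [X in _ - X]mxE !pid_mx_oTh.
rewrite !mxE /= !add0r /circle_length /= => kpi.
have : (k * 2 + 1)%:~R * pi = 0 :> R.
  rewrite intrD intrM; move: kpi; rewrite mulr2n; lra.
move/eqP; rewrite mulf_eq0 [pi == 0]gt_eqF ?pi_gt0// orbF intr_eq0 => /eqP.
lia.
Qed.

End Solution.

Theorem corollary1p4 (R : realType) (eta : R) (eta_gt0 : 0 < eta) :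
  exists (n : nat) (N : closedRiemannian R n)
         (u : R -> 'rV[R]_2 -> N) (g : R -> 'rV[R]_2 -> 'M[R]_2),
    [/\ teichmuller_flow eta u g,
        in_teich_compact [set g t | t in [set t : R | 0 <= t]],
        ~ (exists u_oo g_oo, smooth_cvg +oo u g u_oo g_oo)
      & exists (t t' : nat -> R) (u_oo u_oo' : 'rV[R]_2 -> N)
               (g_oo g_oo' : 'rV[R]_2 -> 'M[R]_2),
          [/\ t @ \oo --> +oo /\ t' @ \oo --> +oo,
              smooth_cvg \oo (u \o t) (g \o t) u_oo g_oo,
              smooth_cvg \oo (u \o t') (g \o t') u_oo' g_oo'
            & different_minimal_surfaces u_oo u_oo']].
Proof.
have pi0 : 0 <= pi :> R := pi_ge0 R.
exists 4%N, target, solution, (fun _ _ => 1%:M); split.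
- exact: solution_flow.
- exists [set (0, 1)]; split; first exact: compact_set1.
    by move=> _ -> /=; exact: ltr01.
  by move=> _ [t _ <-]; exists (0, 1) => //; exact: teich_equiv1.
- move=> [u_oo [g_oo [_ _ _ ucvg _]]].
  have u_lim phi : 0 <= phi -> u_oo 0 = limit_slice phi 0.
    move=> phi0; have [_ _ _ rcvg _] := smooth_cvg_return phi0.
    have lim1 : (solution \o return_time phi) n 0 @[n --> \oo] -->
        limit_slice phi 0.
      exact: smooth_cvg_map_pointwise rcvg.
    have lim : solution s 0 @[s --> +oo] --> u_oo 0.
      exact: smooth_cvg_map_pointwise ucvg.
    have lim2 := cvg_comp _ _ (return_time_cvg phi0) lim.
    exact: (cvg_unique (@carrier_hausdorff _ _ (@target R)) lim2 lim1).
  by apply: (@limit_slices_disjoint R 0 0); rewrite -!u_lim.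
- exists (return_time 0), (return_time pi), (limit_slice 0), (limit_slice pi).
  exists (fun=> 1%:M), (fun=> 1%:M); split.
  + by split; exact: return_time_cvg.
  + exact: smooth_cvg_return.
  + exact: smooth_cvg_return.
  + split; [by apply: slice_minimal_immersion; rewrite mxE..|].
    move=> same; have : range (limit_slice pi) (limit_slice 0 (0 : 'rV[R]_2)).
      by rewrite -same; exists 0.
    by move=> [y _ /esym]; exact: limit_slices_disjoint.
Qed.
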